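(* Fix $p\ge3$ and let $(\beta,h)\in\Theta$ be $p$-regular, with $h$ known and $\bm X\sim\mathbb P_{\beta,h,p}$. Let $m_*$ be the unique global maximizer of $H=H_{\beta,h,p}$. Then as $N\to\infty$: (a) If $m_*\ne0$, then $N^{1/2}(\hat\beta_N-\beta)\to N\big(0,-\frac{H''(m_* )}{p^2m_*^{2p-2}}\big)$ in distribution. (b) If $m_*=0$ (equivalently $h=0$ and $\beta<\tilde\beta_p$), then $\hat\beta_N\to\frac12\delta_{\tilde\beta_p}+\frac12\delta_{-\tilde\beta_p}$ in distribution if $p$ is odd, and $\hat\beta_N\to\gamma_p\delta_{-\infty}+(1-\gamma_p)\delta_{\tilde\beta_p}$ in distribution if $p$ is even, where $\gamma_p=\mathbb P(Z^p\le\mathbb EZ^p)$ with $Z\sim N(0,1)$.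
   Context: The $p$-tensor Curie–Weiss model on $\{-1,1\}^N$: $\mathbb P_{\beta,h,p}(\bm X)=\frac{1}{2^NZ_N(\beta,h,p)}\exp\{N(\beta\bar X_N^p+h\bar X_N)\}$ with $\bar X_N=N^{-1}\sum_iX_i$, $(\beta,h)\in\mathbb R^2$; $\Theta=[0,\infty)\times\mathbb R$. $I(x)=\frac12[(1+x)\log(1+x)+(1-x)\log(1-x)]$, $H_{\beta,h,p}(x)=\beta x^p+hx-I(x)$ on $[-1,1]$. $(\beta,h)$ is $p$-regular if $H_{\beta,h,p}$ has a unique global maximizer $m_*\in(-1,1)$ with $H''(m_* )<0$. $\tilde\beta_p=\sup\{\beta\ge0:\sup_{x\in[-1,1]}H_{\beta,0,p}(x)=0\}$. For known $h$, $\hat\beta_N\in[-\infty,\infty]$ is the maximum likelihood estimate of $\beta$ over $\beta\in\mathbb R$, i.e. the solution in $\beta$ of $\mathbb E_{\beta,h,p}(\bar X_N^p)=\bar X_N^p$. Convergence to laws with atoms at $\pm\infty$ is weak convergence on the extended line $[-\infty,\infty]$. *)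

(* Defs.v *)
From HB Require Import structures.
From mathcomp Require Import all_boot all_order all_algebra.
From mathcomp Require Import all_classical all_reals all_analysis.
Set Implicit Arguments. Unset Strict Implicit. Unset Printing Implicit Defensive.
Import Order.TTheory GRing.Theory Num.Theory.
Import numFieldNormedType.Exports.
Local Open Scope classical_set_scope.
Local Open Scope ring_scope.

Section CW.
Variable R : realType.

(* a configuration X in {-1,1}^N is encoded as x : {ffun 'I_N -> bool}, X_i = spin (x i) *)
Definition spin (b : bool) : R := if b then 1 else -1.

Definition mag (N : nat) (x : {ffun 'I_N -> bool}) : R :=
  (\sum_(i < N) spin (x i)) / N%:R.

Definition cw_weight (beta h : R) (p N : nat) (x : {ffun 'I_N -> bool}) : R :=
  expR (N%:R * (beta * mag x ^+ p + h * mag x)).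

Definition cw_Z (beta h : R) (p N : nat) : R :=
  (\sum_(x : {ffun 'I_N -> bool}) cw_weight beta h p x) / 2 ^+ N.

Definition cw_prob (beta h : R) (p N : nat) (x : {ffun 'I_N -> bool}) : R :=
  cw_weight beta h p x / (2 ^+ N * cw_Z beta h p N).

Definition cw_mean_p (beta h : R) (p N : nat) : R :=
  \sum_(x : {ffun 'I_N -> bool}) cw_prob beta h p x * mag x ^+ p.

(* b is a maximum likelihood estimate (in [-oo,+oo]) of beta, given h, p and
   data x: it solves E_b(\bar X^p) = \bar X^p, with the value +oo (resp. -oo)
   when the observed \bar X^p is >= (resp. <=) E_b(\bar X^p) for all real b. *)
Definition is_mle (h : R) (p N : nat) (x : {ffun 'I_N -> bool}) (b : \bar R) : Prop :=
  match b with
  | EFin b' => cw_mean_p b' h p N = mag x ^+ p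
  | +oo%E => forall b' : R, cw_mean_p b' h p N <= mag x ^+ p
  | -oo%E => forall b' : R, mag x ^+ p <= cw_mean_p b' h p N
  end.

Definition Ient (x : R) : R :=
  ((1 + x) * ln (1 + x) + (1 - x) * ln (1 - x)) / 2.

Definition Hfun (beta h : R) (p : nat) (x : R) : R :=
  beta * x ^+ p + h * x - Ient x.

Definition is_gmax (beta h : R) (p : nat) (m : R) : Prop :=
  -1 <= m <= 1 /\ forall x, -1 <= x <= 1 -> Hfun beta h p x <= Hfun beta h p m.

Definition H2 (beta h : R) (p : nat) (x : R) : R :=
  derive1 (derive1 (Hfun beta h p)) x.

Definition p_regular (p : nat) (beta h : R) : Prop :=
  exists m, (forall m', is_gmax beta h p m' <-> m' = m) /\
            -1 < m < 1 /\ H2 beta h p m < 0.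

Definition tilde_beta (p : nat) : R :=
  sup [set b : R | 0 <= b /\
        sup [set y | exists2 x : R, -1 <= x <= 1 & y = Hfun b 0 p x] = 0].

Definition gauss_pdf (v x : R) : R :=
  expR (- (x ^+ 2) / (2 * v)) / Num.sqrt (2 * pi * v).

Definition gamma_p (p : nat) : R :=
  let mp := Rintegral lebesgue_measure setT (fun x => x ^+ p * gauss_pdf 1 x) in
  Rintegral lebesgue_measure [set x : R | x ^+ p <= mp] (gauss_pdf 1).

(* Weak convergence on the extended line [-oo,+oo]: the law of Y_N(X) with
   X ~ P_N converges to the law whose expectation functional is L. *)
Definition conv_dist (P : forall N, {ffun 'I_N -> bool} -> R)
  (Y : forall N, {ffun 'I_N -> bool} -> \bar R) (L : (\bar R -> R) -> R) : Prop :=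
  forall f : \bar R -> R, continuous f -> (exists M : R, forall y, `|f y| <= M) ->
    (fun N => \sum_(x : {ffun 'I_N -> bool}) P N x * f (Y N x)) @ \oo --> L f.

End CW.

(* Main.v *)
Require Import Defs.
From HB Require Import structures.
From mathcomp Require Import all_boot all_order all_algebra.
From mathcomp Require Import all_classical all_reals all_analysis.
From mathcomp Require Import measurable_realfun ring lra.
Import Order.TTheory GRing.Theory Num.Theory.
Import numFieldNormedType.Exports.
Local Open Scope classical_set_scope.
Local Open Scope ring_scope.
Set Implicit Arguments.
Unset Strict Implicit.
Unset Printing Implicit Defensive.

(** The probability that the magnetization equals [x_k = 2k/N - 1] is
   proportional to [s(N, k) exp(N H(x_k))], where [s(N, k)] is of order
   [1/sqrt N] near an interior maximizer [m] of [H].  Constants cancel in the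
   normalization, so Stirling's formula is only needed up to its constant.
   In the coordinate [z = kappa sqrt N (x - m)] the sums over [k] are integrals
   of step functions; the bound [H(x) <= H(m) - c (x - m)^2] on [[-1, 1]] and
   dominated convergence give a Gaussian limit for all statistics that grow at
   most exponentially in [z].

   As [b |-> E_b X^p] is nondecreasing, the estimate lies above or below [b]
   according to the sign of [X^p - E_b X^p].  When [m <> 0], the logarithm of
   [E_beta exp(t sqrt N (X^p - m^p))] tends to [t^2 / (2 v)], and Jensen's
   inequality squeezes [sqrt N (E_b X^p - m^p)] at [b = beta + t / sqrt N]
   between its difference quotients.  When [m = 0], [N^(p/2) E_b X^p] tends to
   [E Z^p] for every subcritical [b], including all negative [b] if [p] is even,
   whereas Jensen's inequality between [b] and [0] keeps [b E_b X^p] away from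
   0 for supercritical [b].  So the estimate jumps to [+- tilde_beta], except
   that it escapes to [-oo] when [p] is even and [Z^p < E Z^p]. *)

(** * Binomial weights and Stirling's formula without its constant *)

(** A maximum likelihood estimate need not be unique (for N = 1 and p even, every real b solves the
    likelihood equation), so it is never computed. The only access to it is through two comparisons
    that every solution satisfies, [mle_le] and [mle_ge].

    Convergence in law is tested directly on functions f. The value f(estimate) is itself a
    statistic to which [laplace_expectation] applies, provided that, for every z outside a
    Lebesgue-null set, configurations with scaled coordinate near z have f(estimate) near a
    prescribed Psi z. In case (a), Psi is f on the real line. In case (b), Psi takes two values and
    its jump set, where z^p = E Z^p, is the null set. Hence neither distribution functions nor
    tightness are needed, and infinite values of the estimate cost nothing.

    The parameter enters only through ratios of partition functions: Jensen's inequality in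
    finite-difference form replaces every derivative in beta, so limits of moment generating
    functions suffice and need not be differentiated. *)

Section LogBounds.
Variable R : realType.
Implicit Types x y t : R.

Lemma is_derive_within_continuous (f df : R -> R) (a b : R) :
  (forall x, a <= x <= b -> is_derive x 1 f (df x)) ->
  {within `[a, b], continuous f}.
Proof.
move=> fd; apply: derivable_within_continuous => x; rewrite in_itv/= => xab.
by have [] := fd _ xab.
Qed.

Lemma is_derive_ge0_le (f df : R -> R) (a b : R) : a <= b ->
  (forall x, a <= x <= b -> is_derive x 1 f (df x)) ->
  (forall x, a <= x <= b -> 0 <= df x) -> f a <= f b.
Proof.
move=> ab fd df0; have fd' x : x \in `]a, b[%R -> is_derive x 1 f (df x).
  by rewrite in_itv/= => /andP[/ltW ax /ltW xb]; apply: fd; rewrite ax.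
have [c] := MVT_segment ab fd' (is_derive_within_continuous fd).
rewrite in_itv/= => cab e; rewrite -subr_ge0 e mulr_ge0 ?subr_ge0//.
exact: df0.
Qed.

(** Tuned to y = (k+1)/k, where it gives (k + 1/2) ln y >= 1, that is, the monotonicity of
    [ln_stirling]. At y = (1+x)/(1-x) it becomes artanh x >= x. *)
Lemma ln_ge y : 1 <= y -> 2 * (y - 1) / (y + 1) <= ln y.
Proof.
move=> y1; rewrite -subr_ge0.
pose f z : R := ln z - 2 * (z - 1) / (z + 1).
have -> : 0 = f 1 by rewrite /f ln1 subrr mulr0 mul0r subrr.
apply: (is_derive_ge0_le (df := fun z => z^-1 - 4 / (z + 1) ^+ 2) y1).
  move=> x /andP[x1 _].
  have x0 : 0 < x by lra.
  have xp : x + 1 != 0 by lra.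
  have dl := is_derive1_ln x0.
  have d1 : is_derive x 1 (fun z : R => z + 1) 1.
    by apply: is_derive_eq; rewrite addr0.
  have dV := @is_deriveV _ (fun z : R => z + 1) _ _ _ xp d1.
  rewrite /f; apply: is_derive_eq.
  rewrite /GRing.scale/=; field.
  by rewrite xp; lra.
move=> x /andP[x1 _].
have -> : x^-1 - 4 / (x + 1) ^+ 2 = (x - 1) ^+ 2 / (x * (x + 1) ^+ 2).
  by field; apply/andP; split; lra.
by rewrite divr_ge0 ?sqr_ge0// mulr_ge0 ?sqr_ge0//; lra.
Qed.

(** At y = (k+1)/k this bounds (k + 1/2) ln y - 1 by 1/(4k) - 1/(4(k+1)), which telescopes. *)
Lemma ln_le_half_subV y : 1 <= y -> ln y <= (y - y^-1) / 2.
Proof.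
move=> y1; rewrite -subr_ge0.
pose f z : R := (z - z^-1) / 2 - ln z.
have -> : 0 = f 1 by rewrite /f ln1 invr1 subrr mul0r subrr.
apply: (is_derive_ge0_le (df := fun z => (1 + z ^- 2) / 2 - z^-1) y1).
  move=> x /andP[x1 _].
  have x0 : 0 < x by lra.
  have xp : x != 0 by lra.
  have dl := is_derive1_ln x0.
  have dV := @is_deriveV _ id _ _ _ xp (is_derive_id x 1).
  rewrite /f; apply: is_derive_eq.
  rewrite /GRing.scale/=; field.
  by lra.
move=> x /andP[x1 _].
have -> : (1 + x ^- 2) / 2 - x^-1 = (x - 1) ^+ 2 / (2 * x ^+ 2).
  by field; lra.
by rewrite divr_ge0 ?sqr_ge0// mulr_ge0 ?sqr_ge0//; lra.
Qed.

Lemma artanh_ge x : 0 <= x < 1 -> x <= (ln (1 + x) - ln (1 - x)) / 2.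
Proof.
move=> /andP[x0 x1].
rewrite -ln_div ?posrE; [|lra|lra].
have y1 : 1 <= (1 + x) / (1 - x) by rewrite ler_pdivlMr; lra.
have := ln_ge y1.
have -> : 2 * ((1 + x) / (1 - x) - 1) / ((1 + x) / (1 - x) + 1) = 2 * x.
  by field; apply/andP; split; lra.
by lra.
Qed.

End LogBounds.

Section BinomialWeights.
Variable R : realType.
Implicit Types N k : nat.

Definition pts N k : R := 2 * k%:R / N%:R - 1.

(* With [k] up spins the magnetization is [x_k = pts N k], and
   [2^-N 'C(N, k) = bincorr N k * exp (- N I(x_k))]. *)
Definition bincorr N k : R :=
  'C(N, k)%:R / 2 ^+ N * expR (N%:R * Ient (pts N k)).

(** The mass at k of the Poisson law of mean k. *)
Definition power_fact k : R := k%:R ^+ k * expR (- k%:R) / k`!%:R.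

Definition stirling k : R := power_fact k * Num.sqrt k%:R.

Definition ln_stirling k : R :=
  k%:R * ln k%:R - k%:R - ln k`!%:R + ln k%:R / 2.

Lemma factR_gt0 k : 0 < k`!%:R :> R.
Proof. by rewrite ltr0n fact_gt0. Qed.

(** The case k = 0 serves the endpoints of [-1, 1], where y = 0: the convention 0 ln 0 = 0 then
    agrees with 0^0 = 1. *)
Lemma expR_natM_ln k (y : R) : 0 < y \/ k = 0 -> expR (k%:R * ln y) = y ^+ k.
Proof.
case=> [y0|->]; last by rewrite mul0r expR0 expr0.
by rewrite expRM_natl lnK// posrE.
Qed.

Lemma stirlingE k : (0 < k)%N -> stirling k = expR (ln_stirling k).
Proof.
move=> k0; have kp : 0 < k%:R :> R by rewrite ltr0n.
rewrite /stirling /power_fact /ln_stirling !(expRD, expRN) expR_natM_ln; last by left.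
rewrite lnK ?posrE ?factR_gt0//.
by rewrite -powR12_sqrt ?ler0n// /powR (gt_eqF kp) [2^-1 * _]mulrC.
Qed.

Lemma ln_stirlingS k : (0 < k)%N ->
  0 <= ln_stirling k.+1 - ln_stirling k <= (4 * k%:R)^-1 - (4 * k.+1%:R)^-1.
Proof.
move=> k0; have kp : 0 < k%:R :> R by rewrite ltr0n.
have kp1 : 0 < k.+1%:R :> R by rewrite ltr0n.
have y1 : 1 <= (k.+1%:R / k%:R : R) by rewrite ler_pdivlMr// mul1r ler_nat.
have -> : ln_stirling k.+1 - ln_stirling k = (k%:R + 1 / 2) * ln (k.+1%:R / k%:R) - 1.
  rewrite /ln_stirling factS natrM lnM ?posrE ?factR_gt0// ln_div ?posrE//.
  by rewrite -[k.+1%:R]natr1; field.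
have := ln_ge y1; have := ln_le_half_subV y1; set L := ln _ => hu hl.
apply/andP; split.
  have : (k%:R + 1 / 2) * (2 * (k.+1%:R / k%:R - 1) / (k.+1%:R / k%:R + 1)) <= (k%:R + 1 / 2) * L.
    by rewrite ler_wpM2l//; lra.
  have -> : (k%:R + 1 / 2) * (2 * (k.+1%:R / k%:R - 1) / (k.+1%:R / k%:R + 1)) = 1 :> R.
    by rewrite -[k.+1%:R]natr1; field; apply/andP; split; lra.
  by lra.
have : (k%:R + 1 / 2) * L <= (k%:R + 1 / 2) * ((k.+1%:R / k%:R - (k.+1%:R / k%:R)^-1) / 2).
  by rewrite ler_wpM2l//; lra.
have -> : (k%:R + 1 / 2) * ((k.+1%:R / k%:R - (k.+1%:R / k%:R)^-1) / 2)
  = 1 + ((4 * k%:R)^-1 - (4 * k.+1%:R)^-1) :> R.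
  by move: kp1; rewrite -[k.+1%:R]natr1 => kp1; field; apply/andP; split; lra.
by rewrite lerBlDl.
Qed.

(** The upper bound absorbs the telescoping increments; -3/4 makes it an equality at k = 0, where
    [ln_stirling 1] is -1. *)
Lemma ln_stirling_bounds k : -1 <= ln_stirling k.+1 <= - 3 / 4 - (4 * k.+1%:R)^-1.
Proof.
elim: k => [|k /andP[IH1 IH2]].
  have -> : ln_stirling 1 = -1 by rewrite /ln_stirling (_ : 1`! = 1)%N// ln1; lra.
  by apply/andP; split; lra.
have /andP[] := ln_stirlingS (ltn0Sn k); move: IH1 IH2.
move: ((4 * k.+2%:R)^-1) ((4 * k.+1%:R)^-1) (ln_stirling _) (ln_stirling _) => a b c d *.
by apply/andP; split; lra.
Qed.

Lemma stirling_bounds k : (0 < k)%N -> expR (-1) <= stirling k <= 1.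
Proof.
case: k => // k _; have /andP[h1 h] := ln_stirling_bounds k.
rewrite stirlingE// ler_expR h1 expR_le1 (le_trans h)//.

Qed.

(* Only the existence of the limit matters (its value 1/sqrt(2 pi), given by
   Stirling's formula, cancels between numerator and normalization). *)
Lemma stirling_cvg : exists2 c : R, 0 < c & stirling k @[k --> \oo] --> c.
Proof.
have nd : nondecreasing_seq (fun k => ln_stirling k.+1).
  apply/nondecreasing_seqP => k; rewrite -subr_ge0.
  by have /andP[] := ln_stirlingS (ltn0Sn k).
have ub : has_ubound (range (fun k => ln_stirling k.+1)).
  exists (- 3 / 4) => _ [k _ <-]; have /andP[_ h] := ln_stirling_bounds k.
  by rewrite (le_trans h)// gerBl invr_ge0 mulr_ge0// ler0n.
have cv := nondecreasing_is_cvgn nd ub.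
exists (expR (limn (fun k => ln_stirling k.+1))); first exact: expR_gt0.
rewrite -cvg_shiftS.
under eq_fun do rewrite stirlingE//.
by apply: continuous_cvg => //; exact: continuous_expR.
Qed.

Lemma ptsD1 N k : 1 + pts N k = 2 * k%:R / N%:R.
Proof. by rewrite /pts addrC subrK. Qed.

Lemma pts1B N k : (0 < N)%N -> (k <= N)%N ->
  1 - pts N k = 2 * (N - k)%:R / N%:R.
Proof.
move=> N0 kN; have Np : N%:R != 0 :> R by rewrite pnatr_eq0 -lt0n.
by rewrite natrB// /pts; field.
Qed.

Lemma pts_itv N k : (0 < N)%N -> (k <= N)%N -> -1 <= pts N k <= 1.
Proof.
move=> N0 kN; have := ptsD1 N k; have := pts1B N0 kN.
have : 0 <= 2 * (N - k)%:R / N%:R :> R by rewrite divr_ge0// mulr_ge0.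
have : 0 <= 2 * k%:R / N%:R :> R by rewrite divr_ge0// mulr_ge0.
by lra.
Qed.

Lemma expR_Ient N k : (0 < N)%N -> (k <= N)%N ->
  expR (N%:R * Ient (pts N k)) =
  2 ^+ N * ((k%:R / N%:R) ^+ k * ((N - k)%:R / N%:R) ^+ (N - k)).
Proof.
move=> N0 kN; have Np : 0 < N%:R :> R by rewrite ltr0n.
have Nn : N%:R != 0 :> R by rewrite pnatr_eq0 -lt0n.
rewrite /Ient pts1B// ptsD1.
have -> (a b : R) : N%:R * ((2 * k%:R / N%:R * a + 2 * (N - k)%:R / N%:R * b) / 2) =
  k%:R * a + (N - k)%:R * b by field.
have pos j : 0 < 2 * j%:R / N%:R :> R \/ j = 0%N.
  by case: j => [|j]; [right|left; rewrite divr_gt0// mulr_gt0// ltr0n].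
rewrite expRD !expR_natM_ln//.
rewrite -[in RHS](subnKC kN) exprD -!mulrA !exprMn (subnKC kN).
by ring.
Qed.

Lemma bincorrE N k : (0 < N)%N -> (k <= N)%N ->
  bincorr N k = 'C(N, k)%:R * ((k%:R / N%:R) ^+ k * ((N - k)%:R / N%:R) ^+ (N - k)).
Proof.
move=> N0 kN; rewrite /bincorr expR_Ient// mulrA divfK//.
Qed.

Lemma bincorr_ge0 N k : 0 <= bincorr N k.
Proof. by rewrite mulr_ge0 ?expR_ge0// divr_ge0// exprn_ge0. Qed.

(** By [bincorrE] this is the probability of k under the binomial law with parameters N and k/N, one
    term of the expansion of (y + x)^N = 1. *)
Lemma bincorr_le1 N k : (0 < N)%N -> (k <= N)%N -> bincorr N k <= 1.
Proof.
move=> N0 kN; rewrite bincorrE//.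
have Nn : N%:R != 0 :> R by rewrite pnatr_eq0 -lt0n.
set x : R := k%:R / N%:R; set y : R := (N - k)%:R / N%:R.
have x0 : 0 <= x by rewrite divr_ge0.
have y0 : 0 <= y by rewrite divr_ge0.
have xy : y + x = 1 by rewrite /x /y natrB//; field.
apply: (@le_trans _ _ ((y + x) ^+ N)); last by rewrite xy expr1n.
rewrite exprDn (bigD1 (Ordinal (kN : (k < N.+1)%N)))//= mulr_natl [y ^+ _ * _]mulrC lerDl.
by apply: sumr_ge0 => i _; rewrite mulrn_wge0// mulr_ge0// exprn_ge0.
Qed.

(** An exact identity: the powers and exponentials of k, N - k and N cancel, and 1 - x_k^2 =
    4k(N-k)/N^2 turns the remaining square roots into the last factor. At k = 0 and k = N that
    factor would divide by 0. *)
Lemma sqrtN_bincorrE N k : (0 < k < N)%N ->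
  Num.sqrt N%:R * bincorr N k =
  stirling k * stirling (N - k) / stirling N * (2 / Num.sqrt (1 - pts N k ^+ 2)).
Proof.
move=> /andP[k0 kN]; have N0 : (0 < N)%N by apply: leq_ltn_trans kN.
have kp : 0 < k%:R :> R by rewrite ltr0n.
have Np : 0 < N%:R :> R by rewrite ltr0n.
have lp : 0 < (N - k)%:R :> R by rewrite ltr0n subn_gt0.
have -> : 1 - pts N k ^+ 2 = (2 / N%:R) ^+ 2 * (k%:R * (N - k)%:R).
  have -> : 1 - pts N k ^+ 2 = (1 - pts N k) * (1 + pts N k) by ring.
  by rewrite pts1B ?(ltnW kN)// ptsD1; field; lra.
rewrite sqrtrM ?sqr_ge0// sqrtr_sqr ger0_norm; last by rewrite divr_ge0.
rewrite sqrtrM ?ler0n// bincorrE ?(ltnW kN)//.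
have bf : ('C(N, k)%:R * (k`!%:R * (N - k)`!%:R) = N`!%:R :> R).
  by rewrite -!natrM bin_fact// ltnW.
have -> : ('C(N, k)%:R = N`!%:R / (k`!%:R * (N - k)`!%:R) :> R).
  by rewrite -bf mulfK// mulf_neq0// gt_eqF// factR_gt0.
rewrite /stirling /power_fact.
have sN : N%:R ^+ N = N%:R ^+ k * N%:R ^+ (N - k) :> R by rewrite -exprD subnKC// ltnW.
have eN : expR (- N%:R) = expR (- k%:R) * expR (- (N - k)%:R) :> R.
  by rewrite -expRD -opprD -natrD subnKC// ltnW.
rewrite eN sN !expr_div_n.
have s2 := sqr_sqrtr (ltW Np).
have := factR_gt0 N; have := factR_gt0 k; have := factR_gt0 (N - k).
have : 0 < Num.sqrt N%:R :> R by rewrite sqrtr_gt0.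
have : 0 < Num.sqrt k%:R :> R by rewrite sqrtr_gt0.
have : 0 < Num.sqrt (N - k)%:R :> R by rewrite sqrtr_gt0.
have : 0 < N%:R ^+ k :> R by rewrite exprn_gt0.
have : 0 < N%:R ^+ (N - k) :> R by rewrite exprn_gt0.
have := expR_gt0 (- k%:R : R); have := expR_gt0 (- (N - k)%:R : R).
move: s2; move: N%:R (Num.sqrt N%:R) (Num.sqrt k%:R) (Num.sqrt (N - k)%:R)
  (expR (- k%:R)) (expR (- (N - k)%:R)) (N%:R ^+ k) (N%:R ^+ (N - k))
  (N`!%:R) (k`!%:R) ((N - k)`!%:R) (k%:R ^+ k) ((N - k)%:R ^+ (N - k)).
move=> n a b c d e f g h i j l o <- *.
by field; rewrite !lt0r_neq0.
Qed.

End BinomialWeights.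

(** * The energy near and away from its maximizer *)

Section EntropyFunction.
Variable R : realType.
Implicit Types x y m : R.


(** Apply ln t < t to t = 1/sqrt x. The bound vanishes at 0, which gives continuity of x ln x
    there. *)
Lemma norm_xlnx_le x : 0 < x <= 1 -> `|x * ln x| <= 2 * Num.sqrt x.
Proof.
move=> /andP[x0 x1]; have s0 : 0 < Num.sqrt x by rewrite sqrtr_gt0.
have xs : x = Num.sqrt x ^+ 2 by rewrite sqr_sqrtr// ltW.
have l0 : ln x <= 0 by exact: ln_le0.
rewrite normrM (ler0_norm l0) (gtr0_norm x0).
have : - ln x <= 2 * (Num.sqrt x)^-1.
  rewrite -lnV ?posrE// {1}xs -exprVn lnXn ?invr_gt0// -[leLHS]mulr_natl.
  by rewrite ler_pM2l// ltW// ln_sublinear// invr_gt0.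
move=> /(ler_wpM2l (ltW x0)) /le_trans; apply.
move: s0 xs; set s := Num.sqrt x => s0 xs.
by rewrite xs le_eqVlt; apply/orP; left; apply/eqP; field; lra.
Qed.

(** As [ln] is 0 on nonpositive arguments, the function vanishes on the negative half-line, and
    continuity holds on the whole line with 0 the only delicate point. *)
Lemma continuous_xlnx : continuous (fun x : R => x * ln x).
Proof.
move=> x; have [x0|x0|->] := ltgtP x 0.
- rewrite /continuous_at (ln0 (ltW x0)) mulr0; apply: cvg_near_cst.
  near=> y; rewrite ln0 ?mulr0//.
  by apply/ltW; near: y; exact: lt_nbhsl.
- by apply: cvgM; [exact: cvg_id|exact: continuous_ln].
- apply/cvgrPdist_le => e e0; rewrite mul0r.
  near=> y; rewrite sub0r normrN.
  have [y0|y0] := leP y 0; first by rewrite ln0// mulr0 normr0 ltW.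
  have ye : y < Num.min 1 ((e / 2) ^+ 2).
    near: y; apply: lt_nbhsl; rewrite lt_min ltr01 exprn_gt0// divr_gt0//.
  move: ye; rewrite lt_min => /andP[y1 ye].
  apply: (le_trans (norm_xlnx_le _)); first by rewrite y0 ltW.
  rewrite -ler_pdivlMl// mulrC -(@ger0_norm _ (e / 2)) ?divr_ge0 ?ltW// -sqrtr_sqr.
  by rewrite ltr_sqrt ?exprn_gt0 ?divr_gt0.
Unshelve. all: by end_near. Qed.

Lemma continuous_Ient : continuous (@Ient R).
Proof.
move=> x; rewrite /Ient; apply: cvgM; last exact: cvg_cst.
apply: cvgD.
- apply: (@continuous_comp _ _ _ (fun x : R => 1 + x) (fun x => x * ln x));
    last exact: continuous_xlnx.
  by apply: cvgD; [exact: cvg_cst|exact: cvg_id].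
- apply: (@continuous_comp _ _ _ (fun x : R => 1 - x) (fun x => x * ln x));
    last exact: continuous_xlnx.
  by apply: cvgB; [exact: cvg_cst|exact: cvg_id].
Qed.

Lemma IentN x : Ient (- x) = Ient x.
Proof. by rewrite /Ient opprK addrC. Qed.

Lemma Ient0 : Ient 0 = 0 :> R.
Proof. by rewrite /Ient addr0 subr0 ln1 mulr0 addr0 mul0r. Qed.

Lemma Ient1 : Ient 1 = ln 2 :> R.
Proof.
rewrite /Ient subrr mul0r addr0 (_ : 1 + 1 = 2)//.
by rewrite mulrC mulKf.
Qed.

Lemma is_derive_ln1D x : -1 < x -> is_derive x 1 (fun y : R => ln (1 + y)) (1 + x)^-1.
Proof.
move=> x1; have x0 : 0 < 1 + x by lra.
have dl := is_derive1_ln x0.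
have d1 : is_derive x 1 (fun y : R => 1 + y) 1.
  by have := is_deriveD (is_derive_cst (1 : R) x 1) (is_derive_id x 1); rewrite add0r.
by have := is_derive1_comp dl d1; rewrite mulr1.
Qed.

Lemma is_derive_ln1B x : x < 1 -> is_derive x 1 (fun y : R => ln (1 - y)) (- (1 - x)^-1).
Proof.
move=> x1; have x0 : 0 < 1 - x by lra.
have dl := is_derive1_ln x0.
have d1 : is_derive x 1 (fun y : R => 1 - y) (-1).
  by have := is_deriveB (is_derive_cst (1 : R) x 1) (is_derive_id x 1); rewrite sub0r.
by have := @is_derive1_comp _ (@ln R) (fun y : R => 1 - y) _ _ _ dl d1; rewrite mulrN1.
Qed.

Lemma is_derive_Ient x : -1 < x < 1 ->
  is_derive x 1 (@Ient R) ((ln (1 + x) - ln (1 - x)) / 2).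
Proof.
move=> /andP[x1 x2].
have dp := is_derive_ln1D x1; have dm := is_derive_ln1B x2.
rewrite /Ient; apply: is_derive_eq.
by rewrite /GRing.scale/=; field; apply/andP; split; lra.
Qed.

Lemma is_derive_artanh x : -1 < x < 1 ->
  is_derive x 1 (fun y : R => (ln (1 + y) - ln (1 - y)) / 2) (1 - x ^+ 2)^-1.
Proof.
move=> /andP[x1 x2].
have dp := is_derive_ln1D x1; have dm := is_derive_ln1B x2.
apply: is_derive_eq.
have h : 1 - x ^+ 2 = (1 - x) * (1 + x) by ring.
by rewrite /GRing.scale/= h; field; apply/andP; split; lra.
Qed.

Lemma Ient_ge x : -1 <= x <= 1 -> x ^+ 2 / 2 <= Ient x.
Proof.
wlog x0 : x / 0 <= x.
  move=> h; have [/h//|x0 /andP[x1 x2]] := leP 0 x.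
  by rewrite -sqrrN -IentN; apply: h; lra.
(* The derivative argument fails at the endpoint 1; there [ln_ge] at 2 gives I(1) = ln 2 >= 2/3 >
   1/2. *)
move=> /andP[_]; rewrite le_eqVlt => /predU1P[->|x1].
  rewrite Ient1 expr1n.
  have : 2 * (2 - 1) / (2 + 1) <= ln 2 :> R by apply: ln_ge; lra.
  by rewrite (_ : 2 * (2 - 1) / (2 + 1) = 2 / 3 :> R); [lra|field].
rewrite -subr_ge0.
pose f y := Ient y - y ^+ 2 / 2.
have -> : 0 = f 0 by rewrite /f Ient0 expr0n/= mul0r subrr.
apply: (is_derive_ge0_le (df := fun z => (ln (1 + z) - ln (1 - z)) / 2 - z) x0).
  move=> y /andP[y0 yx]; have dI : is_derive y 1 (@Ient R) ((ln (1 + y) - ln (1 - y)) / 2).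
    by apply: is_derive_Ient; lra.
  rewrite /f; apply: is_derive_eq.
  by rewrite /GRing.scale/=; field.
by move=> y /andP[y0 yx]; rewrite subr_ge0; apply: artanh_ge; lra.
Qed.

Lemma is_derive_eps (f : R -> R) x d : is_derive x 1 f d ->
  forall e, 0 < e -> exists2 r, 0 < r &
    forall y, `|y - x| < r -> `|f y - f x - d * (y - x)| <= e * `|y - x|.
Proof.
move=> [df <-] e e0.
have : (fun h => h^-1 *: (f (h *: 1 + x) - f x)) @ 0^' --> 'D_1 f x by exact: df.
move=> /cvgrPdist_le /(_ e e0)[r /= r0 hr].
exists r => // y yr; have [->|yx] := eqVneq y x.
  by rewrite !subrr mulr0 subrr normr0 mulr0.
have yx0 : y - x != 0 by rewrite subr_eq0.
have /= := hr (y - x).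
rewrite sub0r normrN => /(_ yr yx0).
rewrite [(y - x) *: 1]mulr1 subrK => h.
have -> : f y - f x - 'D_1 f x * (y - x) = - (('D_1 f x - (y - x)^-1 *: (f y - f x)) * (y - x)).
  by rewrite /GRing.scale/= mulrBl mulrAC mulVf// mul1r opprB.
by rewrite normrN normrM ler_wpM2r.
Qed.

End EntropyFunction.

Section Energy.
Variables (R : realType) (beta h : R) (p : nat).
Implicit Types x y m : R.
Local Notation H := (Hfun beta h p).

Definition dHfun x : R :=
  beta * (p%:R * x ^+ p.-1) + h - (ln (1 + x) - ln (1 - x)) / 2.

Definition d2Hfun x : R :=
  beta * (p%:R * (p.-1%:R * x ^+ p.-2)) - (1 - x ^+ 2)^-1.

Lemma continuous_Hfun : continuous H.
Proof.
move=> x; rewrite /Hfun; apply: cvgB; last exact: continuous_Ient.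
apply: cvgD; apply: cvgM; try exact: cvg_cst; last exact: cvg_id.
exact: exprn_continuous.
Qed.

Lemma is_deriveX_nat k x : is_derive x 1 (fun y : R => y ^+ k) (k%:R * x ^+ k.-1).
Proof.
apply: DeriveDef; first exact: exprn_derivable.
by rewrite exp_derive [LHS]mulr1.
Qed.

Lemma is_derive_Hfun x : -1 < x < 1 -> is_derive x 1 H (dHfun x).
Proof.
move=> x1; have dI := is_derive_Ient x1; have dX := is_deriveX_nat p x.
rewrite /Hfun; apply: is_derive_eq.
by rewrite /GRing.scale/= /dHfun; ring.
Qed.

Lemma is_derive_dHfun x : -1 < x < 1 -> is_derive x 1 dHfun (d2Hfun x).
Proof.
move=> x1; have dI := is_derive_artanh x1; have dX := is_deriveX_nat p.-1 x.
have d0 := is_derive_cst h x 1.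
have dM : is_derive x 1 (fun y => beta * (p%:R * y ^+ p.-1))
    (beta * (p%:R * (p.-1%:R * x ^+ p.-2))).
  by apply: is_derive_eq; rewrite /GRing.scale/=; ring.
by have := is_deriveB (is_deriveD dM d0) dI; rewrite addr0.
Qed.

Lemma H2E x : -1 < x < 1 -> H2 beta h p x = d2Hfun x.
Proof.
move=> x1; have [_ <-] := is_derive_dHfun x1.
rewrite /H2 derive1E; apply: near_eq_derive.
near=> y; have y1 : -1 < y < 1.
  have : y \in `](-1), 1[ by near: y; apply: near_in_itvoo; rewrite in_itv.
  by rewrite in_itv.
by rewrite derive1E; have [_ ->] := is_derive_Hfun y1.
Unshelve. all: by end_near. Qed.

Lemma dHfun_gmax m : -1 < m < 1 -> is_gmax beta h p m -> dHfun m = 0.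
Proof.
move=> m1 [_ gm]; have [_ <-] := is_derive_Hfun m1.
suff : is_derive m 1 H 0 by case.
apply: (@derive1_at_max R H (-1) 1 m); first by lra.
- by move=> t; rewrite in_itv/= => t1; have [] := is_derive_Hfun t1.
- by rewrite in_itv.
- by move=> t; rewrite in_itv/= => /andP[t1 t2]; apply: gm; rewrite !ltW.
Qed.

(** Second-order expansion with Peano remainder. Subtracting the quadratic term leaves a function
    whose derivative is o(y - m), by differentiability of H' at m; the mean value theorem turns this
    into o((x - m)^2). *)
Lemma Hfun_expansion m e : -1 < m < 1 -> dHfun m = 0 -> 0 < e ->
  exists2 r, 0 < r & forall x, `|x - m| < r ->
    `|H x - H m - d2Hfun m / 2 * (x - m) ^+ 2| <= e * (x - m) ^+ 2.
Proof.
move=> m1 dm0 e0; have [r r0 hr] := is_derive_eps (is_derive_dHfun m1) e0.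
have s0 : 0 < Num.min r (Num.min (1 - m) (m + 1)).
  by rewrite !lt_min r0; apply/andP; split; lra.
exists (Num.min r (Num.min (1 - m) (m + 1))) => // x.
rewrite !lt_min !ltr_norml => /andP[xr /andP[xm1 xm2]].
pose g y := H y - d2Hfun m / 2 * (y - m) ^+ 2.
pose dg y := dHfun y - d2Hfun m * (y - m).
have gd y : -1 < y < 1 -> is_derive y 1 g (dg y).
  move=> y1; have dH := is_derive_Hfun y1.
  have dB : is_derive y 1 (fun y => y - m) 1.
    by have := is_deriveB (is_derive_id y 1) (is_derive_cst m y 1); rewrite subr0.
  have dX := @is_deriveX _ _ (fun y => y - m) 2 y 1 1 dB.
  rewrite /g; apply: is_derive_eq.
  by rewrite /GRing.scale/= /dg expr1; field.
have gm : g m = H m by rewrite /g subrr expr0n/= mulr0 subr0.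
have key c : `|c - m| <= `|x - m| -> g x - g m = dg c * (x - m) ->
    `|H x - H m - d2Hfun m / 2 * (x - m) ^+ 2| <= e * (x - m) ^+ 2.
  move=> cm E.
  have -> : H x - H m - d2Hfun m / 2 * (x - m) ^+ 2 = g x - g m by rewrite gm /g; ring.
  rewrite E -[(x - m) ^+ 2](ger0_norm (sqr_ge0 _)) normrX expr2 normrM mulrA ler_wpM2r//.
  have := hr c; rewrite dm0 subr0 => /(_ _)/le_trans; apply.
    by apply: (le_lt_trans cm); rewrite ltr_norml.
  by rewrite ler_wpM2l// ltW.
have [xm|mx] := leP x m.
  have [c|c|c] := @MVT_segment _ g dg x m xm.
  - by rewrite in_itv/= => cx; apply: gd; lra.
  - by apply: (@is_derive_within_continuous _ _ dg) => y ?; apply: gd; lra.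
  rewrite in_itv/= => cx E; apply: (key c); last by move: E; lra.
  by rewrite !ler0_norm; lra.
have [c|c|c] := @MVT_segment _ g dg m x (ltW mx).
- by rewrite in_itv/= => cx; apply: gd; lra.
- by apply: (@is_derive_within_continuous _ _ dg) => y ?; apply: gd; lra.
rewrite in_itv/= => cx E; apply: (key c) => //.
by rewrite !ger0_norm; lra.
Qed.

(** By compactness the maximum over [a, b] is attained; were it equal to H m, its location would be
    a second global maximizer. *)
Lemma Hfun_gap m a b :
  (forall m', is_gmax beta h p m' <-> m' = m) ->
  -1 <= a -> b <= 1 -> (forall x, a <= x <= b -> x != m) ->
  exists2 eta, 0 < eta & forall x, a <= x <= b -> H x <= H m - eta.
Proof.
move=> um a1 b1 abm.
have [ab|ba] := leP a b; last by exists 1 => // x; lra.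
have [|c] := @EVT_max R H a b ab.
  by apply: continuous_subspaceT => x; exact: continuous_Hfun.
rewrite in_itv/= => cab hc.
have [_ gm] := (um m).2 erefl.
exists (H m - H c); last first.
  by move=> x xab; rewrite opprB addrC subrK; apply: hc; rewrite in_itv.
rewrite subr_gt0 lt_neqAle gm ?andbT; last by lra.
apply: contra (abm _ cab) => /eqP E; apply/eqP/um; split; first by lra.
by move=> x x1; rewrite E; exact: gm.
Qed.

Lemma Hfun_quadratic_bound m :
  (forall m', is_gmax beta h p m' <-> m' = m) -> -1 < m < 1 -> d2Hfun m < 0 ->
  exists2 c, 0 < c & forall x, -1 <= x <= 1 -> H x <= H m - c * (x - m) ^+ 2.
Proof.
move=> um m1 d2.
have gm := (um m).2 erefl.
have e0 : 0 < - d2Hfun m / 4 by lra.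
have [r r0 hr] := Hfun_expansion m1 (dHfun_gmax m1 gm) e0.
have [||x|eta1 eta10 h1] := @Hfun_gap m (-1) (m - r) um;
  [lra|lra|by move=> ?; rewrite lt_eqF//; lra|].
have [||x|eta2 eta20 h2] := @Hfun_gap m (m + r) 1 um;
  [lra|lra|by move=> ?; rewrite gt_eqF//; lra|].
(* Near m, the expansion with error -H''/4 leaves the coefficient H''/4. Away from m, (x - m)^2 <= 4
   makes eta/4 times it at most the gap eta. *)
exists (Num.min (- d2Hfun m / 4) (Num.min (eta1 / 4) (eta2 / 4))).
  by rewrite !lt_min e0 !divr_gt0.
move=> x x1; set c := Num.min _ _.
have c0 : 0 <= (x - m) ^+ 2 by exact: sqr_ge0.
have c4 : (x - m) ^+ 2 <= 4 by nra.
have ca : c <= - d2Hfun m / 4 by rewrite ge_min lexx.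
have ce1 : c <= eta1 / 4 by rewrite !ge_min lexx orbT.
have ce2 : c <= eta2 / 4 by rewrite !ge_min lexx !orbT.
have [xr|rx] := ltP `|x - m| r.
  by have := hr x xr; rewrite ler_norml => /andP[_]; nra.
have [xm|mx] := leP x m.
  by move: rx; rewrite ler0_norm ?subr_le0// => rx; have := h1 x; nra.
by move: rx; rewrite gtr0_norm ?subr_gt0// => rx; have := h2 x; nra.
Qed.

End Energy.

(** * Laplace's method for the magnetization *)

Section GaussDensity.
Variable R : realType.
Implicit Types v x : R.
Local Notation mu := (@lebesgue_measure R).

Lemma gauss_pdfE v x : 0 < v -> gauss_pdf v x = normal_pdf 0 (Num.sqrt v) x.
Proof.
move=> v0; rewrite normal_pdfE ?gt_eqF ?sqrtr_gt0// /normal_peak /normal_fun.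
rewrite sqr_sqrtr ?ltW// subr0 /gauss_pdf mulrC -mulr_natl.
rewrite -[v *+ 2]mulr_natl -[(v * pi) *+ 2]mulr_natl mulr1.
by congr ((Num.sqrt _)^-1 * _); ring.
Qed.

Lemma gauss_pdf_gt0 v x : 0 < v -> 0 < gauss_pdf v x.
Proof.
move=> v0; rewrite divr_gt0 ?expR_gt0// sqrtr_gt0 !mulr_gt0//; exact: pi_gt0.
Qed.

Lemma expR_gauss_pdf v x : 0 < v ->
  expR (- x ^+ 2 / (2 * v)) = Num.sqrt (2 * pi * v) * gauss_pdf v x.
Proof.
move=> v0; have s0 : 0 < Num.sqrt (2 * pi * v).
  by rewrite sqrtr_gt0 mulr_gt0// mulr_gt0// pi_gt0.
by rewrite /gauss_pdf [RHS]mulrC divfK// gt_eqF.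
Qed.

Lemma gauss_pdfN v x : gauss_pdf v (- x) = gauss_pdf v x.
Proof. by rewrite /gauss_pdf sqrrN. Qed.

Lemma continuous_gauss_pdf v : 0 < v -> continuous (gauss_pdf v).
Proof.
move=> v0; rewrite (_ : gauss_pdf v = normal_pdf 0 (Num.sqrt v)).
  by apply: continuous_normal_pdf; rewrite gt_eqF// sqrtr_gt0.
by apply/funext => x; exact: gauss_pdfE.
Qed.

Lemma measurable_gauss_pdf v : 0 < v -> measurable_fun setT (gauss_pdf v).
Proof. by move=> v0; apply: continuous_measurable_fun; exact: continuous_gauss_pdf. Qed.

Lemma integrable_gauss_pdf v : 0 < v ->
  mu.-integrable setT (fun x => (gauss_pdf v x)%:E).
Proof.
move=> v0; under eq_fun do rewrite gauss_pdfE//.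
exact: integrable_normal_pdf.
Qed.

Lemma integral_gauss_pdf v : 0 < v -> (\int[mu]_x (gauss_pdf v x)%:E = 1)%E.
Proof.
move=> v0; under eq_integral do rewrite gauss_pdfE//.
exact: integral_normal_pdf.
Qed.

End GaussDensity.

(** * The grid of magnetizations in the scaled coordinate *)

Section Cells.
Variable R : realType.
Variables (kappa m : R).
Hypothesis kappa0 : kappa != 0.
Hypothesis m1 : -1 < m < 1.
Implicit Types (N k : nat) (z : R).
Local Notation mu := (@lebesgue_measure R).
Local Notation x_ := (pts R).

Definition zc N k : R := kappa * (Num.sqrt N%:R * (x_ N k - m)).

(* The affine map sending [zc N k] to [k]. *)
Definition zindex N z : R :=
  N%:R * (1 + m) / 2 + z * Num.sqrt N%:R / (2 * kappa).

(** Defined through the index so that disjointness does not depend on the sign of [kappa], which is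
    negative for p even and m < 0; only the closed end of the interval depends on it. *)
Definition cell N k : set R := [set z | k%:R <= zindex N z < k.+1%:R].

Lemma sqrtN_gt0 N : (0 < N)%N -> 0 < Num.sqrt N%:R :> R.
Proof. by move=> N0; rewrite sqrtr_gt0 ltr0n. Qed.

Lemma sqrt_natE N : N%:R = Num.sqrt N%:R ^+ 2 :> R.
Proof. by rewrite sqr_sqrtr ?ler0n. Qed.

Lemma zindexB N k z : (0 < N)%N ->
  z - zc N k = (zindex N z - k%:R) * (2 * kappa / Num.sqrt N%:R).
Proof.
move=> N0; have := sqrtN_gt0 N0; have := sqrt_natE N.
rewrite /zindex /zc /pts; move: (N%:R) (Num.sqrt _) => n s -> s0.
by field; rewrite kappa0/=; lra.
Qed.

Lemma zcS N k : (0 < N)%N -> zc N k.+1 - zc N k = 2 * kappa / Num.sqrt N%:R.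
Proof.
move=> N0; have := sqrtN_gt0 N0; have := sqrt_natE N.
rewrite /zc /pts -[k.+1%:R]natr1; move: (N%:R) (Num.sqrt _) => n s -> s0.
by field; lra.
Qed.

Lemma cellE N k : (0 < N)%N -> cell N k =
  if 0 < kappa then `[zc N k, zc N k.+1[%classic else `]zc N k.+1, zc N k]%classic.
Proof.
move=> N0; have s0 := sqrtN_gt0 N0.

case: ifP => k0; rewrite /cell; apply/seteqP.
  have c0 : 0 < 2 * kappa / Num.sqrt N%:R by rewrite divr_gt0// mulr_gt0.
  suff E z : (k%:R <= zindex N z < k.+1%:R) = (z \in `[zc N k, zc N k.+1[).
    by split=> z /=; rewrite E.
  rewrite in_itv/= -(subr_ge0 (zc N k)) -(subr_lt0 (zc N k.+1)) !zindexB//.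
  by rewrite pmulr_lge0// pmulr_llt0// subr_ge0 subr_lt0.
have c0 : 2 * kappa / Num.sqrt N%:R < 0.
  by rewrite pmulr_llt0 ?invr_gt0// pmulr_rlt0// lt_neqAle kappa0/= leNgt k0.
suff E z : (k%:R <= zindex N z < k.+1%:R) = (z \in `]zc N k.+1, zc N k]).
  by split=> z /=; rewrite E.
rewrite in_itv/= -(subr_gt0 (zc N k.+1)) -(subr_le0 (zc N k)) !zindexB//.
by rewrite nmulr_lgt0// nmulr_lle0// subr_ge0 subr_lt0 andbC.
Qed.

Lemma measurable_cell N k : (0 < N)%N -> measurable (cell N k).
Proof. by move=> N0; rewrite cellE//; case: ifP => _; exact: measurable_itv. Qed.

Lemma lebesgue_measure_cell N k : (0 < N)%N ->
  mu (cell N k) = (2 * `|kappa| / Num.sqrt N%:R)%:E.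
Proof.
move=> N0; have s0 := sqrtN_gt0 N0; rewrite cellE//; have := zcS k N0.
case: ifP => k0 E; rewrite lebesgue_measure_itv/= lte_fin -subr_gt0.
  have c0 : 0 < 2 * kappa / Num.sqrt N%:R by rewrite divr_gt0// mulr_gt0.
  by rewrite E c0 -EFinB E gtr0_norm.
have kn : kappa < 0 by rewrite lt_neqAle kappa0/= leNgt k0.
have c0 : 0 < - (2 * kappa / Num.sqrt N%:R).
  by rewrite oppr_gt0 pmulr_llt0 ?invr_gt0// pmulr_rlt0.
by rewrite -opprB E c0 -EFinB -opprB E ltr0_norm// mulrN mulNr.
Qed.

Lemma integrable_indic_cell N k : (0 < N)%N ->
  mu.-integrable setT (fun z => (\1_(cell N k) z)%:E).
Proof.
move=> N0; have mc := measurable_cell k N0; apply/integrableP; split.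
  by apply/measurable_EFinP; exact: measurable_indic.
under eq_integral do rewrite /= ger0_norm//.
by rewrite integral_indic//= setIT lebesgue_measure_cell// ltry.
Qed.

Lemma cell_inj N j k z : cell N j z -> cell N k z -> j = k.
Proof.
rewrite /cell/= => /andP[a b] /andP[c d]; apply/eqP; rewrite eqn_leq.
have : (j%:R < k.+1%:R :> R) by exact: le_lt_trans d.
have : (k%:R < j.+1%:R :> R) by exact: le_lt_trans b.
by rewrite !ltr_nat !ltnS => -> ->.
Qed.

Lemma cell_dist N k z : (0 < N)%N -> cell N k z ->
  `|zc N k - z| <= 2 * `|kappa| / Num.sqrt N%:R.
Proof.
move=> N0; rewrite /cell/= => /andP[a b]; have s0 := sqrtN_gt0 N0.
rewrite distrC zindexB// normrM normrM normrM (gtr0_norm (_ : 0 < 2))//.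
rewrite [`|_^-1|]gtr0_norm ?invr_gt0// ler_piMl//.
by rewrite ger0_norm ?subr_ge0// lerBlDr; move: b; rewrite -[k.+1%:R]natr1; lra.
Qed.

Lemma cvg_sqrt_nat : Num.sqrt (n%:R : R) @[n --> \oo] --> +oo.
Proof.
apply/cvgryPge => A; near=> n.
have An : Num.max A 0 ^+ 2 <= n%:R by near: n; exact: nbhs_infty_ger.
have M0 : 0 <= Num.max A 0 by rewrite le_max lexx orbT.
rewrite (@le_trans _ _ (Num.max A 0))// ?le_max ?lexx//.
by rewrite -[leLHS](ger0_norm M0) -sqrtr_sqr ler_wsqrtr.
Unshelve. all: by end_near. Qed.

Lemma cvg_sqrt_nat_inv (c : R) : c / Num.sqrt (n%:R : R) @[n --> \oo] --> 0.
Proof.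
rewrite -(mulr0 c); apply: cvgM; first exact: cvg_cst.
apply/gtr0_cvgV0; last exact: cvg_sqrt_nat.
by near=> n; rewrite sqrtN_gt0//; near: n; exact: nbhs_infty_gt.
Unshelve. all: by end_near. Qed.

(** Since [zindex N z] / N tends to (1 + m)/2, which lies strictly between 0 and 1, its integer part
    is eventually a legitimate index. *)
Lemma near_cell z : \forall N \near \oo, exists2 k, (k <= N)%N & cell N k z.
Proof.
pose c : R := z / (2 * kappa).
have /andP[ma mb] := m1.
have e0 : 0 < Num.min ((1 + m) / 2) ((1 - m) / 2).
  by rewrite lt_min; apply/andP; split; lra.
have /cvgrPdist_lt/(_ _ e0) := cvg_sqrt_nat_inv c.
apply: filter_app; near=> N; rewrite sub0r normrN ltr_norml.
have N0 : (0 < N)%N by near: N; exact: nbhs_infty_gt.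
have s0 := sqrtN_gt0 N0; have Np : 0 < N%:R :> R by rewrite ltr0n.
set e := Num.min _ _ => /andP[h1 h2].
have ea : e <= (1 + m) / 2 by rewrite ge_min lexx.
have eb : e <= (1 - m) / 2 by rewrite ge_min lexx orbT.
have E : zindex N z = N%:R * ((1 + m) / 2 + c / Num.sqrt N%:R).
  rewrite /zindex /c; move: s0 (sqrt_natE N); move: (N%:R) (Num.sqrt _) => n s s0 ->.
  by field; rewrite kappa0/=; lra.
have i0 : 0 <= zindex N z by rewrite E mulr_ge0 ?ler0n//; lra.
have i1 : zindex N z < N%:R by rewrite E gtr_pMr//; lra.
exists (Num.truncn (zindex N z)); last by rewrite /cell/=; exact: truncn_itv.
by rewrite -(ler_nat R) (le_trans _ (ltW i1))// truncn_le.
Unshelve. all: by end_near. Qed.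

End Cells.

Lemma cvg_exprn (R : realType) (T : Type) (F : set_system T) (FF : Filter F)
  (f : T -> R) (l : R) n : f x @[x --> F] --> l -> f x ^+ n @[x --> F] --> l ^+ n.
Proof.
move=> fl; elim: n => [|n IH]; first exact: cvg_cst.
by rewrite exprS; under eq_fun do rewrite exprS; exact: cvgM.
Qed.

Section LaplaceTerms.
Variables (R : realType) (H : R -> R) (kappa m a c : R).
Hypothesis kappa0 : kappa != 0.
Hypothesis m1 : -1 < m < 1.
Hypothesis a0 : 0 < a.
Hypothesis c0 : 0 < c.
Hypothesis Hquad : forall x, -1 <= x <= 1 -> H x <= H m - c * (x - m) ^+ 2.
Hypothesis Hexp : forall e, 0 < e -> exists2 r, 0 < r &
  forall x, `|x - m| < r ->
    `|H x - H m + a / 2 * (x - m) ^+ 2| <= e * (x - m) ^+ 2.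
Implicit Types (N k : nat) (z : R).
Local Notation mu := (@lebesgue_measure R).
Local Notation x_ := (pts R).
Local Notation z_ := (zc kappa m).
Local Notation v := (kappa ^+ 2 / a).

Definition lterm N k : R :=
  Num.sqrt N%:R * bincorr R N k * expR (N%:R * (H (x_ N k) - H m)).

Lemma lterm_ge0 N k : 0 <= lterm N k.
Proof. by rewrite !mulr_ge0 ?expR_ge0 ?bincorr_ge0. Qed.

Lemma zc_sqr N k : N%:R * (x_ N k - m) ^+ 2 = z_ N k ^+ 2 / kappa ^+ 2.
Proof.
rewrite /zc 2!exprMn -sqrt_natE mulrAC divff ?mul1r//.
by rewrite expf_neq0.
Qed.

(** Near -1 and 1 the Stirling factor 2 / sqrt(1 - x^2) is not bounded. There |x_k - m| >= d, and
    the trivial bound sqrt N * 1 <= N is absorbed by half of the quadratic decay. *)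
Lemma sqrtN_bincorr_bound : exists2 C : R, 0 < C & forall N k,
  (0 < N)%N -> (k <= N)%N ->
  Num.sqrt N%:R * bincorr R N k <= C * expR (c / 2 * (N%:R * (x_ N k - m) ^+ 2)).
Proof.
have /andP[ma mb] := m1.
pose d : R := Num.min ((1 + m) / 2) ((1 - m) / 2).
have da : d <= (1 + m) / 2 by rewrite ge_min lexx.
have db : d <= (1 - m) / 2 by rewrite ge_min lexx orbT.
have d0 : 0 < d by rewrite lt_min; apply/andP; split; lra.
(* [C1] uses that Stirling ratios lie in [e^-1, 1] and that 1 - x^2 >= d; [C2] comes from y <= e^y
   at y = c N d^2 / 2. *)
pose C1 : R := expR 1 * (2 / Num.sqrt d).
pose C2 : R := 2 / (c * d ^+ 2).
have C10 : 0 < C1 by rewrite mulr_gt0 ?expR_gt0// divr_gt0// sqrtr_gt0.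
have C20 : 0 < C2 by rewrite divr_gt0// mulr_gt0// exprn_gt0.
exists (C1 + C2); first exact: addr_gt0.
move=> N k N0 kN; have s0 : 0 < Num.sqrt N%:R :> R := sqrtN_gt0 R N0.
have N1 : 1 <= N%:R :> R by rewrite ler1n.
have Np : 0 < N%:R :> R by rewrite ltr0n.
have [near_m|far_m] := ltP `|x_ N k - m| d.
  move: near_m; rewrite ltr_norml => /andP[h1 h2].
  have kN0 : (0 < k < N)%N.
    rewrite lt0n ltn_neqAle kN andbT; apply/andP; split; apply/negP => /eqP E.
      by have := ptsD1 R N k; rewrite E mulr0 mul0r -E => ?; lra.
    have E' : (N - k)%N = 0%N by rewrite E subnn.
    by have := pts1B R N0 kN; rewrite E' mulr0 mul0r => ?; lra.
  have dx : d <= 1 - x_ N k ^+ 2 by nra.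
  rewrite sqrtN_bincorrE//; apply: (@le_trans _ _ C1); last first.
    apply: (@le_trans _ _ (C1 + C2)); first by rewrite lerDl ltW.
    rewrite ler_peMr ?(ltW (addr_gt0 C10 C20))//.
    rewrite -[leLHS]expR0 ler_expR; apply: mulr_ge0; first by rewrite divr_ge0// ltW.
    by rewrite mulr_ge0 ?sqr_ge0.
  have [k0 kN'] := andP kN0.
  have /andP[b1 b2] := stirling_bounds R k0.
  have /andP[b3 b4] : expR (-1) <= stirling R (N - k) <= 1.
    by apply: stirling_bounds; rewrite subn_gt0.
  have /andP[b5 b6] := stirling_bounds R N0.
  have e0 := expR_gt0 (-1 : R).
  apply: ler_pM.
  - by rewrite divr_ge0 ?mulr_ge0//; exact: le_trans (ltW e0) _.
  - by rewrite divr_ge0.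
  - rewrite -[leRHS]mul1r; apply: ler_pM.
    + by rewrite mulr_ge0//; exact: le_trans (ltW e0) _.
    + by rewrite invr_ge0; exact: le_trans (ltW e0) _.
    + by rewrite mulr_ile1//; exact: le_trans (ltW e0) _.
    + rewrite -[1 in leRHS]opprK expRN lef_pV2 ?posrE//.
      exact: lt_le_trans e0 _.
  - rewrite ler_pM2l// lef_pV2 ?posrE ?sqrtr_gt0//; last exact: lt_le_trans dx.
    exact: ler_wsqrtr.
have sN : Num.sqrt N%:R <= N%:R :> R.
  rewrite [leRHS]sqrt_natE expr2 ler_peMr ?(ltW s0)//.
  by rewrite -[leLHS]sqrtr1 ler_wsqrtr.
apply: (@le_trans _ _ N%:R).
  by rewrite -[leRHS]mulr1 ler_pM ?bincorr_ge0 ?bincorr_le1// (ltW s0).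
have dx : d ^+ 2 <= (x_ N k - m) ^+ 2.
  rewrite -[leRHS]ger0_norm ?sqr_ge0// normrX lerXn2r// nnegrE ?(ltW d0)//.
apply: (@le_trans _ _ (C2 * expR (c / 2 * (N%:R * d ^+ 2)))).
  rewrite -ler_pdivrMl//; apply: le_trans (expR_ge1Dx _).
  rewrite -[leLHS]add0r lerD//.
  by rewrite le_eqVlt; apply/orP; left; apply/eqP; rewrite /C2; field; rewrite !gt_eqF.
apply: ler_pM; rewrite ?expR_ge0 ?(ltW C20) ?lerDr ?(ltW C10)//.
rewrite ler_expR ler_wpM2l ?divr_ge0 ?(ltW c0)//.
by rewrite ler_wpM2l// ltW.
Qed.

(** [Hquad] supplies decay at rate c, of which [sqrtN_bincorr_bound] spends half. *)
Lemma lterm_bound : exists2 C : R, 0 < C & forall N k,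
  (0 < N)%N -> (k <= N)%N ->
  lterm N k <= C * expR (- (c / (2 * kappa ^+ 2)) * z_ N k ^+ 2).
Proof.
have [C C0 hC] := sqrtN_bincorr_bound; exists C => // N k N0 kN.
have k2 : kappa ^+ 2 != 0 by rewrite expf_neq0.
have -> : - (c / (2 * kappa ^+ 2)) * z_ N k ^+ 2 =
    c / 2 * (N%:R * (x_ N k - m) ^+ 2) + N%:R * (- c * (x_ N k - m) ^+ 2).
  have -> : - (c / (2 * kappa ^+ 2)) * z_ N k ^+ 2 = - (c / 2) * (z_ N k ^+ 2 / kappa ^+ 2).
    by field.
  by rewrite -zc_sqr; field.
rewrite expRD mulrA ler_pM ?expR_ge0 ?mulr_ge0 ?bincorr_ge0//; first exact: hC.
rewrite ler_expR ler_wpM2l//.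
by have := Hquad (pts_itv R N0 kN); lra.
Qed.

Variable cb : R.
Hypothesis cb0 : 0 < cb.
Hypothesis stirling_cb : stirling R k @[k --> \oo] --> cb.

Definition lconst : R := cb * (2 / Num.sqrt (1 - m ^+ 2)).

Lemma lconst_gt0 : 0 < lconst.
Proof.
have /andP[ma mb] := m1.
by rewrite mulr_gt0// divr_gt0// sqrtr_gt0; nra.
Qed.

Section AlongSequence.
Variables (kk : nat -> nat) (z : R).
Hypothesis kkN : \forall N \near \oo, (kk N <= N)%N.
Hypothesis kkz : z_ N (kk N) @[N --> \oo] --> z.

Lemma pts_cvg : x_ N (kk N) @[N --> \oo] --> m.
Proof.
have h : z_ N (kk N) * (kappa^-1 / Num.sqrt N%:R) + m @[N --> \oo] --> z * 0 + m.
  apply: cvgD; last exact: cvg_cst.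
  by apply: cvgM => //; exact: cvg_sqrt_nat_inv.
rewrite mulr0 add0r in h; apply: cvg_trans h; apply: near_eq_cvg.
near=> N; have N0 : (0 < N)%N by near: N; exact: nbhs_infty_gt.
have := sqrtN_gt0 R N0; rewrite /zc; move: (Num.sqrt _) => s s0.
by field; rewrite kappa0 gt_eqF.
Unshelve. all: by end_near. Qed.

Let kk_pinfty (j : nat -> nat) (l : R) : 0 < l ->
  (\forall N \near \oo, l * N%:R <= (j N)%:R) -> j N @[N --> \oo] --> \oo.
Proof.
move=> l0 jl; apply/cvgnyPge => M; near=> N.
rewrite -(ler_nat R); apply: (@le_trans _ _ (l * N%:R)); last by near: N.
rewrite -ler_pdivrMl//; near: N; exact: nbhs_infty_ger.
Unshelve. all: by end_near. Qed.

(** Makes k and N - k grow linearly, so that the limit of Stirling's ratio applies at k, N - k and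
    N. *)
Lemma near_pts_interior : exists2 l : R, 0 < l & \forall N \near \oo,
  [/\ (0 < kk N < N)%N, l * N%:R <= (kk N)%:R & l * N%:R <= (N - kk N)%:R].
Proof.
have /andP[ma mb] := m1.
pose d : R := Num.min ((1 + m) / 2) ((1 - m) / 2).
have da : d <= (1 + m) / 2 by rewrite ge_min lexx.
have db : d <= (1 - m) / 2 by rewrite ge_min lexx orbT.
have d0 : 0 < d by rewrite lt_min; apply/andP; split; lra.
exists (d / 2); first by rewrite divr_gt0.
have /cvgrPdist_lt/(_ _ d0) := pts_cvg.
apply: filter_app; near=> N; rewrite ltr_norml => /andP[h1 h2].
have N0 : (0 < N)%N by near: N; exact: nbhs_infty_gt.
have kN : (kk N <= N)%N by near: N.
have Np : 0 < N%:R :> R by rewrite ltr0n.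
have k2 : (kk N)%:R = N%:R * (1 + x_ N (kk N)) / 2 :> R.
  by rewrite ptsD1; field; lra.
have l2 : (N - kk N)%:R = N%:R * (1 - x_ N (kk N)) / 2 :> R.
  by rewrite pts1B//; field; lra.
have hk : d / 2 * N%:R <= (kk N)%:R by rewrite k2; nra.
have hl : d / 2 * N%:R <= (N - kk N)%:R by rewrite l2; nra.
have dN : 0 < d / 2 * N%:R by rewrite mulr_gt0// divr_gt0.
split => //; apply/andP; split.
  by rewrite -(ltr0n R); exact: lt_le_trans hk.
by rewrite -subn_gt0 -(ltr0n R); exact: lt_le_trans hl.
Unshelve. all: by end_near. Qed.

Lemma sqrtN_bincorr_cvg : Num.sqrt N%:R * bincorr R N (kk N) @[N --> \oo] --> lconst.
Proof.
have [l l0 hl] := near_pts_interior.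
have /andP[ma mb] := m1.
have kk1 : kk N @[N --> \oo] --> \oo.
  by apply: (kk_pinfty l0); apply: filterS hl => N [].
have kk2 : (N - kk N)%N @[N --> \oo] --> \oo.
  by apply: (kk_pinfty l0); apply: filterS hl => N [].
have h : stirling R (kk N) * stirling R (N - kk N) / stirling R N *
    (2 / Num.sqrt (1 - x_ N (kk N) ^+ 2)) @[N --> \oo] -->
    cb * cb / cb * (2 / Num.sqrt (1 - m ^+ 2)).
  apply: cvgM.
    apply: cvgM; last by apply: cvgV => //; rewrite gt_eqF.
    apply: cvgM; first exact: (cvg_comp _ _ kk1 stirling_cb).
    exact: (cvg_comp _ _ kk2 stirling_cb).
  apply: cvgM; first exact: cvg_cst.
  apply: cvgV; first by rewrite gt_eqF// sqrtr_gt0; nra.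
  apply: continuous_cvg; first exact: sqrt_continuous.
  apply: cvgB; first exact: cvg_cst.
  by apply: cvg_exprn; exact: pts_cvg.
rewrite mulfK ?gt_eqF// in h; apply: cvg_trans h; apply: near_eq_cvg.
by apply: filterS hl => N [kN _ _]; rewrite sqrtN_bincorrE.
Qed.

Lemma exponent_cvg :
  N%:R * (H (x_ N (kk N)) - H m) @[N --> \oo] --> - z ^+ 2 / (2 * v).
Proof.
have k2 : 0 < kappa ^+ 2 by rewrite exprn_even_gt0.
have z2 : z_ N (kk N) ^+ 2 @[N --> \oo] --> z ^+ 2.
  exact: cvg_exprn.
have main : - (z_ N (kk N) ^+ 2) / (2 * v) @[N --> \oo] --> - z ^+ 2 / (2 * v).
  by apply: cvgM; [exact: cvgN|exact: cvg_cst].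
suff rem : N%:R * (H (x_ N (kk N)) - H m) + z_ N (kk N) ^+ 2 / (2 * v) @[N --> \oo] --> 0.
  have h : - z_ N (kk N) ^+ 2 / (2 * v) + (N%:R * (H (x_ N (kk N)) - H m) +
      z_ N (kk N) ^+ 2 / (2 * v)) @[N --> \oo] --> - z ^+ 2 / (2 * v) + 0.
    exact: cvgD.
  rewrite addr0 in h.
  apply: cvg_trans h; apply: near_eq_cvg.
  by apply: nearW => N /=; rewrite mulNr addrCA addNr addr0.
apply/cvgrPdist_le => e e0.
(* An eventual bound for N (x_k - m)^2; it converts the relative error of the expansion into an
   absolute one. *)
pose M : R := (z ^+ 2 + 1) / kappa ^+ 2.
have M0 : 0 < M by rewrite divr_gt0// ltr_wpDl// sqr_ge0.
have eM0 : 0 < e / M by rewrite divr_gt0.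
have [r r0 hr] := Hexp eM0.
have /cvgrPdist_lt/(_ _ r0) hx := pts_cvg.
have /cvgrPdist_lt/(_ _ ltr01) hz := z2.
near=> N.
have xr : `|m - x_ N (kk N)| < r by near: N.
have zr : `|z ^+ 2 - z_ N (kk N) ^+ 2| < 1 by near: N.
rewrite distrC in xr; have := hr _ xr => h.
have -> : N%:R * (H (x_ N (kk N)) - H m) + z_ N (kk N) ^+ 2 / (2 * v) =
    N%:R * (H (x_ N (kk N)) - H m + a / 2 * (x_ N (kk N) - m) ^+ 2).
  have -> : z_ N (kk N) ^+ 2 / (2 * v) = a / 2 * (z_ N (kk N) ^+ 2 / kappa ^+ 2).
    by field; rewrite kappa0 gt_eqF.
  by rewrite -zc_sqr; ring.
rewrite sub0r normrN normrM (ger0_norm (ler0n _ _)).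
apply: (@le_trans _ _ (N%:R * (e / M * (x_ N (kk N) - m) ^+ 2))).
  by rewrite ler_wpM2l.
rewrite mulrCA zc_sqr -mulrA ger_pMr// mulrC ler_pdivrMr// mul1r.
rewrite ler_pM2r ?invr_gt0//.
by move: zr; rewrite ltr_norml => /andP[]; lra.
Unshelve. all: by end_near. Qed.

Lemma lterm_cvg :
  lterm N (kk N) @[N --> \oo] --> lconst * expR (- z ^+ 2 / (2 * v)).
Proof.
apply: cvgM; first exact: sqrtN_bincorr_cvg.
by apply: continuous_cvg; [exact: continuous_expR|exact: exponent_cvg].
Qed.

End AlongSequence.
End LaplaceTerms.

(** * Dominated convergence for the Laplace sums *)

Section LaplaceSum.
Variables (R : realType) (H : R -> R) (kappa m a c : R).
Hypothesis kappa0 : kappa != 0.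
Hypothesis m1 : -1 < m < 1.
Hypothesis a0 : 0 < a.
Hypothesis c0 : 0 < c.
Hypothesis Hquad : forall x, -1 <= x <= 1 -> H x <= H m - c * (x - m) ^+ 2.
Hypothesis Hexp : forall e, 0 < e -> exists2 r, 0 < r &
  forall x, `|x - m| < r ->
    `|H x - H m + a / 2 * (x - m) ^+ 2| <= e * (x - m) ^+ 2.
Variable cb : R.
Hypothesis cb0 : 0 < cb.
Hypothesis stirling_cb : stirling R k @[k --> \oo] --> cb.
Variables (Psi_ : nat -> nat -> R) (Psi : R -> R) (K : R) (A : set R).
Local Notation mu := (@lebesgue_measure R).
Hypothesis mPsi : measurable_fun setT Psi.
Hypothesis A0 : mu.-negligible A.
Hypothesis K0 : 0 <= K.
Local Notation x_ := (pts R).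
Local Notation z_ := (zc kappa m).
Local Notation v := (kappa ^+ 2 / a).
Local Notation w := (4 * kappa ^+ 2 / c).
Local Notation cell_ := (cell kappa m).
Local Notation term := (lterm H m).
Hypothesis Psi_K : forall N k, (0 < N)%N -> (k <= N)%N ->
  `|Psi_ N k| <= K * expR (K * `|z_ N k|).
Hypothesis Psi_cvg : forall z, ~ A z -> forall e, 0 < e -> exists2 r, 0 < r &
  \forall N \near \oo, forall k, (k <= N)%N -> `|z_ N k - z| < r ->
    `|Psi_ N k - Psi z| <= e.
Implicit Types (N k : nat) (z : R).

(* Up to the factor [2 |kappa|], the Laplace sum is the integral of [stepf N],
   to which dominated convergence applies. *)
Definition stepf N z : R :=
  \sum_(k < N.+1) Psi_ N k * term N k * \1_(cell_ N k) z.

Lemma stepf_cell N k z : (k <= N)%N -> cell_ N k z ->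
  stepf N z = Psi_ N k * term N k.
Proof.
move=> kN zk; rewrite /stepf (bigD1 (Ordinal (kN : (k < N.+1)%N)))//=.
rewrite indicE mem_set// mulr1 big1 ?addr0// => j jk.
rewrite indicE memNset ?mulr0// => zj; move: jk.
by rewrite -val_eqE/= (cell_inj zj zk) eqxx.
Qed.

Lemma stepf_out N z : (forall k, (k <= N)%N -> ~ cell_ N k z) -> stepf N z = 0.
Proof.
move=> zk; rewrite /stepf big1// => j _.
by rewrite indicE memNset ?mulr0//; apply: zk; rewrite -ltnS.
Qed.

Lemma measurable_stepf N : (0 < N)%N -> measurable_fun setT (stepf N).
Proof.
move=> N0; apply: measurable_sum => k; apply: measurable_funM => //.
by apply: measurable_indic; exact: measurable_cell.
Qed.

Lemma integral_stepf N : (0 < N)%N ->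
  (\int[mu]_z (stepf N z)%:E = (2 * `|kappa| *
    \sum_(k < N.+1) Psi_ N k * (bincorr R N k * expR (N%:R * (H (x_ N k) - H m))))%:E)%E.
Proof.
move=> N0; rewrite /stepf.
under eq_integral do rewrite -sumEFin.
rewrite integral_sum//; last first.
  move=> k; under eq_fun do rewrite EFinM.
  by apply: integrableZl => //; exact: integrable_indic_cell.
rewrite mulr_sumr -sumEFin; apply: eq_bigr => k _.
under eq_integral do rewrite EFinM.
rewrite integralZl//; last exact: integrable_indic_cell.
have mc := @measurable_cell _ _ m kappa0 _ k N0.
rewrite integral_indic//= setIT lebesgue_measure_cell// -EFinM; congr EFin.
rewrite /lterm; have := sqrtN_gt0 R N0; move: (Num.sqrt _) => s s0.
by field; lra.
Qed.

(** On cell k, z_k is within D = 2 |kappa| of z. With decay rate c' = c / (2 kappa^2), the growth K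
    |z_k| costs c'/2 z_k^2 plus a constant, and z_k^2 >= z^2/2 - D^2 leaves exp(- c' z^2 / 4), a
    Gaussian of variance w. *)
Lemma stepf_dominated : exists C : R, forall N z, (0 < N)%N ->
  `|stepf N z| <= C * gauss_pdf w z.
Proof.
have [C1 C10 hC] := lterm_bound kappa0 m1 c0 Hquad.
have k2 : 0 < kappa ^+ 2 by rewrite exprn_even_gt0.
have w0 : 0 < w by rewrite divr_gt0// mulr_gt0.
pose D : R := 2 * `|kappa|.
pose c' : R := c / (2 * kappa ^+ 2).
have c'0 : 0 < c' by rewrite divr_gt0// mulr_gt0.
pose B : R := K ^+ 2 / (2 * c') + c' * D ^+ 2 / 2.
have sw : 0 < Num.sqrt (2 * pi * w) by rewrite sqrtr_gt0 mulr_gt0// mulr_gt0// pi_gt0.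
exists (K * C1 * expR B * Num.sqrt (2 * pi * w)) => N z N0.
have [[k kN zk]|no] := pselect (exists2 k, (k <= N)%N & cell_ N k z); last first.
  rewrite stepf_out ?normr0; last by move=> k kN zk; apply: no; exists k.
  by rewrite !mulr_ge0 ?expR_ge0 ?(ltW C10) ?(ltW sw) ?(ltW (gauss_pdf_gt0 _ w0)).
rewrite (stepf_cell kN zk) normrM (ger0_norm (lterm_ge0 _ _ _ _)).
have -> : K * C1 * expR B * Num.sqrt (2 * pi * w) * gauss_pdf w z =
    K * C1 * expR (B - c' / 4 * z ^+ 2).
  rewrite -mulrA -expR_gauss_pdf// -mulrA -expRD; congr (_ * expR _).
  by rewrite /c'; field; rewrite kappa0 gt_eqF.
apply: (@le_trans _ _ (K * expR (K * `|z_ N k|) * (C1 * expR (- c' * z_ N k ^+ 2)))).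
  by rewrite ler_pM ?lterm_ge0 ?Psi_K ?hC.
rewrite mulrACA ler_wpM2l ?mulr_ge0 ?(ltW C10)// -expRD ler_expR.
have zD : `|z_ N k - z| <= D.
  apply: (le_trans (cell_dist kappa0 N0 zk)).
  rewrite ler_piMr ?mulr_ge0// invf_le1 ?sqrtN_gt0//.
  by rewrite -[leLHS]sqrtr1 ler_sqrt// ler1n.
have h1 : K * `|z_ N k| <= c' / 2 * z_ N k ^+ 2 + K ^+ 2 / (2 * c').
  rewrite -subr_ge0 -[z_ N k ^+ 2]ger0_norm ?sqr_ge0// normrX.
  have -> : c' / 2 * `|z_ N k| ^+ 2 + K ^+ 2 / (2 * c') - K * `|z_ N k| =
      (c' * `|z_ N k| - K) ^+ 2 / (2 * c') by field; rewrite gt_eqF.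
  by rewrite divr_ge0 ?sqr_ge0// mulr_ge0// ltW.
have h2 : z ^+ 2 / 2 - D ^+ 2 <= z_ N k ^+ 2.
  have hD : (z_ N k - z) ^+ 2 <= D ^+ 2.
    rewrite -[leLHS]ger0_norm ?sqr_ge0// normrX lerXn2r// nnegrE//.
    by rewrite /D mulr_ge0.
  have : 0 <= (2 * z_ N k - z) ^+ 2 by exact: sqr_ge0.
  by move: hD; rewrite !expr2; nra.
move: h1 h2; rewrite /B; move: (K * _) (K ^+ 2 / _) => u u' h1 h2.
have := ler_wpM2l (ltW c'0) h2; move: h1; rewrite !mulrBr mulNr.
move: (z_ N k ^+ 2) (z ^+ 2) (D ^+ 2) => zk2 z2 D2.
by lra.
Qed.

Definition lnorm : R :=
  (2 * `|kappa|)^-1 * (lconst m cb * Num.sqrt (2 * pi * v)).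

Lemma lnorm_gt0 : 0 < lnorm.
Proof.
apply: mulr_gt0; first by rewrite invr_gt0 mulr_gt0// normr_gt0.
apply: mulr_gt0; first exact: lconst_gt0.
have v0 : 0 < v by rewrite divr_gt0// exprn_even_gt0.
by rewrite sqrtr_gt0 mulr_gt0// mulr_gt0// pi_gt0.
Qed.

Lemma stepf_cvg z : ~ A z -> stepf N z @[N --> \oo] -->
  Psi z * (lconst m cb * expR (- z ^+ 2 / (2 * v))).
Proof.
move=> Az.
(* The index of the cell containing z; the default 0 is taken only while no cell contains z, hence
   for finitely many N. *)
pose kk N := xget 0%N [set k | (k <= N)%N /\ cell_ N k z].
have hkk : \forall N \near \oo, (kk N <= N)%N /\ cell_ N (kk N) z.
  apply: filterS (near_cell kappa0 m1 z) => N [k kN zk].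
  by rewrite /kk; case: xgetP => [y _ //|/(_ k)/=]; case.
have kkN : \forall N \near \oo, (kk N <= N)%N by apply: filterS hkk => N [].
have kkz : z_ N (kk N) @[N --> \oo] --> z.
  apply/cvgrPdist_lt => e e0.
  have /cvgrPdist_lt/(_ _ e0) := cvg_sqrt_nat_inv (2 * `|kappa|).
  apply: filterS2 (filterI hkk (nbhs_infty_gt 0)) => N [[kN zk] N0].
  rewrite sub0r normrN => h.
  rewrite distrC; apply: (le_lt_trans (cell_dist kappa0 N0 zk)).
  exact: le_lt_trans (ler_norm _) h.
have Psik : Psi_ N (kk N) @[N --> \oo] --> Psi z.
  apply/cvgrPdist_le => e e0; have [r r0 hr] := Psi_cvg Az e0.
  have /cvgrPdist_lt/(_ _ r0) := kkz.
  by apply: filterS3 kkN hr => N kN hN; rewrite (distrC z) (distrC (Psi z)); exact: hN.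
have h : Psi_ N (kk N) * term N (kk N) @[N --> \oo] -->
    Psi z * (lconst m cb * expR (- z ^+ 2 / (2 * v))).
  by apply: cvgM => //; exact: (lterm_cvg kappa0 m1 a0 Hexp cb0 stirling_cb kkN kkz).
apply: cvg_trans h; apply: near_eq_cvg.
by apply: filterS hkk => N [kN zk]; rewrite (stepf_cell kN zk).
Qed.

(** [Psi_] has to approach [Psi] only locally uniformly and off the null set [A], which permits a
    discontinuous limit. *)
Theorem laplace_sum :
  (fun N => \sum_(k < N.+1) Psi_ N k *
     (bincorr R N k * expR (N%:R * (H (x_ N k) - H m)))) @ \oo -->
  lnorm * Rintegral mu setT (fun z => Psi z * gauss_pdf v z).
Proof.
have k2 : 0 < kappa ^+ 2 by rewrite exprn_even_gt0.
have v0 : 0 < v by rewrite divr_gt0.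
have w0 : 0 < w by rewrite divr_gt0// mulr_gt0.
have sv : 0 < Num.sqrt (2 * pi * v) by rewrite sqrtr_gt0 mulr_gt0// mulr_gt0// pi_gt0.
have kn : 0 < 2 * `|kappa| by rewrite mulr_gt0// normr_gt0.
have lim z : Psi z * (lconst m cb * expR (- z ^+ 2 / (2 * v))) =
    lconst m cb * Num.sqrt (2 * pi * v) * (Psi z * gauss_pdf v z).
  by rewrite expR_gauss_pdf//; ring.
have [C hC] := stepf_dominated.
pose f z := (Psi z * (lconst m cb * expR (- z ^+ 2 / (2 * v))))%:E.
have mg : measurable_fun setT (fun z => Psi z * gauss_pdf v z).
  by apply: measurable_funM => //; exact: measurable_gauss_pdf.
(* The index is shifted by one because cells degenerate at N = 0. *)
have [|||||intf _ cv] := @dominated_convergence _ _ R mu setT measurableT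
    (fun n z => (stepf n.+1 z)%:E) f (fun z => (C * gauss_pdf w z)%:E).
- by move=> n; apply/measurable_EFinP; exact: measurable_stepf.
- rewrite /f; under eq_fun do rewrite lim.
  by apply/measurable_EFinP; exact: measurable_funM.
- apply: negligibleS A0 => z /= hz; apply: contrapT => Az; apply: hz => _.
  apply: cvg_EFin; first exact: nearW.
  by have := stepf_cvg Az; rewrite -cvg_shiftS.
- under eq_fun do rewrite EFinM.
  by apply: integrableZl => //; exact: integrable_gauss_pdf.
- by apply/aeW => z n _; rewrite /= lee_fin; exact: hC.
have intg : mu.-integrable setT (fun z => (Psi z * gauss_pdf v z)%:E).
  have -> : (fun z => (Psi z * gauss_pdf v z)%:E) =
      (fun z => ((lconst m cb * Num.sqrt (2 * pi * v))^-1%:E * f z)%E).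
    apply/funext => z; rewrite /f lim -EFinM mulKf// gt_eqF// mulr_gt0//.
    exact: lconst_gt0.
  exact: integrableZl.
have E : (\int[mu]_z f z = (lconst m cb * Num.sqrt (2 * pi * v) *
    Rintegral mu setT (fun z => Psi z * gauss_pdf v z))%:E)%E.
  rewrite -RintegralZl// /Rintegral fineK.
    by apply: eq_integral => z _; rewrite /f lim.
  apply: integrable_fin_num => //.
  under eq_fun do rewrite EFinM.
  exact: integrableZl.
rewrite E in cv; have {}cv := @fine_cvg _ _ _ _ _ _ cv.
rewrite -cvg_shiftS.
have h : (2 * `|kappa|)^-1 * fine (\int[mu]_z (stepf n.+1 z)%:E) @[n --> \oo] -->
    lnorm * Rintegral mu setT (fun z => Psi z * gauss_pdf v z).
  rewrite (_ : lnorm * _ = (2 * `|kappa|)^-1 * (lconst m cb * Num.sqrt (2 * pi * v) *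
    Rintegral mu setT (fun z => Psi z * gauss_pdf v z))); last by rewrite /lnorm !mulrA.
  by apply: cvgM; [exact: cvg_cst|exact: cv].
apply: cvg_trans h; apply: near_eq_cvg; apply: nearW => n.
by rewrite /= integral_stepf//= mulKf// gt_eqF.
Qed.

End LaplaceSum.

(** * From sums over configurations to sums over the number of up spins *)

Section Configurations.
Variable N : nat.
Implicit Types x : {ffun 'I_N -> bool}.

Definition upcount x : nat := #|[pred i | x i]|.

Lemma upcount_le x : (upcount x <= N)%N.
Proof. by rewrite -[X in (_ <= X)%N]card_ord max_card. Qed.

Lemma card_upcount k : #|[pred x | upcount x == k]| = 'C(N, k).
Proof.
rewrite -[in RHS](card_ord N) -card_draws.
pose f x : {set 'I_N} := finset (fun i => x i).
have fi : injective f.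
  move=> x y /finset.setP xy; apply/ffunP => i.
  by have := xy i; rewrite !finset.in_set.
rewrite -(fintype.card_image fi); apply: eq_card => B; apply/fintype.imageP/idP.
  by case=> x xk ->; rewrite finset.in_set finset.cardsE.
rewrite finset.in_set => Bk; exists [ffun i => i \in B].
  rewrite inE /upcount -(eqP Bk); apply/eqP/eq_card => i.
  by rewrite inE ffunE.
by apply/finset.setP => i; rewrite finset.in_set ffunE.
Qed.

Lemma sum_upcount (V : nmodType) (F : {ffun 'I_N -> bool} -> V) :
  \sum_x F x = \sum_(k < N.+1) \sum_(x | upcount x == k) F x.
Proof.
have lt x : (upcount x < N.+1)%N by rewrite ltnS upcount_le.
by rewrite (partition_big (fun x => Ordinal (lt x)) xpredT).
Qed.

Lemma mag_pts (R : realType) x : (0 < N)%N -> mag R x = pts R N (upcount x).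
Proof.
move=> N0; have Nn : N%:R != 0 :> R by rewrite pnatr_eq0 -lt0n.
rewrite /mag /pts; have -> : \sum_(i < N) spin R (x i) = 2 * (upcount x)%:R - N%:R.
  rewrite (eq_bigr (fun i => 2 * (x i)%:R - 1)); last first.
    by move=> i _; rewrite /spin; case: (x i); rewrite ?mulr1n ?mulr0n; ring.
  rewrite big_split/= sumrN sumr_const card_ord -mulr_sumr; congr (2 * _ - _).
  rewrite /upcount -sum1_card natr_sum [RHS]big_mkcond/=.
  by apply: eq_bigr => i _; rewrite inE; case: (x i).
by field.
Qed.

End Configurations.

Section Expectation.
Variables (R : realType) (beta h : R) (p : nat).
Local Notation H := (Hfun beta h p).
Local Notation mu := (@lebesgue_measure R).

Definition cw_expect N (F : {ffun 'I_N -> bool} -> R) : R :=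
  \sum_x cw_prob beta h p x * F x.

(* A maximum likelihood estimate need not be a function of the magnetization
   alone, so statistics are averaged over the configurations with [k] up spins. *)
Definition up_average N (F : {ffun 'I_N -> bool} -> R) k : R :=
  (\sum_(x | upcount x == k) F x) / 'C(N, k)%:R.

Definition lsum m N (f : nat -> R) : R :=
  \sum_(k < N.+1) f k * (bincorr R N k * expR (N%:R * (H (pts R N k) - H m))).

Lemma cw_weight_gt0 N (x : {ffun 'I_N -> bool}) : 0 < cw_weight beta h p x.
Proof. exact: expR_gt0. Qed.

Lemma cw_weight_sum_gt0 N : 0 < \sum_(x : {ffun 'I_N -> bool}) cw_weight beta h p x.
Proof.
rewrite (bigD1 [ffun=> true])//= ltr_pwDl ?cw_weight_gt0// sumr_ge0// => x _.
exact/ltW/cw_weight_gt0.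
Qed.

Lemma cw_probE N (x : {ffun 'I_N -> bool}) : cw_prob beta h p x =
  cw_weight beta h p x / \sum_(y : {ffun 'I_N -> bool}) cw_weight beta h p y.
Proof. by rewrite /cw_prob /cw_Z mulrCA divff ?mulr1// expf_neq0. Qed.

Lemma cw_prob_ge0 N (x : {ffun 'I_N -> bool}) : 0 <= cw_prob beta h p x.
Proof. by rewrite cw_probE divr_ge0 ?ltW ?cw_weight_gt0 ?cw_weight_sum_gt0. Qed.

Lemma cw_prob_sum1 N : \sum_(x : {ffun 'I_N -> bool}) cw_prob beta h p x = 1.
Proof.
under eq_bigr do rewrite cw_probE.
by rewrite -mulr_suml divff// gt_eqF// cw_weight_sum_gt0.
Qed.

Lemma cw_expectE N F : cw_expect F =
  (\sum_(x : {ffun 'I_N -> bool}) cw_weight beta h p x * F x) /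
  \sum_(y : {ffun 'I_N -> bool}) cw_weight beta h p y.
Proof.
rewrite /cw_expect mulr_suml; apply: eq_bigr => x _.
by rewrite cw_probE mulrAC.
Qed.

(** Writing beta x^p + h x as H + I in the exponent produces [bincorr]. The point m only normalizes
    and may be arbitrary; [wsum_growth] uses it with a point that need not maximize H. *)
Lemma sum_cw_weight m N (F : {ffun 'I_N -> bool} -> R) : (0 < N)%N ->
  \sum_x cw_weight beta h p x * F x =
  2 ^+ N * expR (N%:R * H m) * lsum m N (up_average F).
Proof.
move=> N0; rewrite sum_upcount /lsum mulr_sumr; apply: eq_bigr => k _.
have C0 : 'C(N, k)%:R != 0 :> R by rewrite pnatr_eq0 -lt0n bin_gt0 -ltnS.
rewrite (eq_bigr (fun x => expR (N%:R * (H (pts R N k) + Ient (pts R N k))) * F x)); last first.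
  move=> x /eqP xk; rewrite /cw_weight mag_pts// xk /Hfun; congr (expR _ * _).
  by ring.
rewrite -mulr_sumr /up_average /bincorr; set S := \sum_(_ | _) _.
move: (H m) (H (pts R N k)) (Ient _) => u w i.
rewrite mulrDr expRD mulrBr expRB; move: (expR_gt0 (N%:R * u)).
move: (expR (N%:R * u)) (expR (N%:R * w)) (expR (N%:R * i)) => a b e a0.
have p0 : 2 ^+ N != 0 :> R by rewrite expf_neq0.
by field; rewrite p0 C0 gt_eqF.
Qed.

Lemma up_average1 N k : (k <= N)%N -> up_average (fun _ : {ffun 'I_N -> bool} => 1) k = 1.
Proof.
move=> kN; rewrite /up_average sumr_const card_upcount divff//.
by rewrite pnatr_eq0 -lt0n bin_gt0.
Qed.

Lemma up_average_close N (F : {ffun 'I_N -> bool} -> R) k l B : (k <= N)%N ->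
  (forall x, upcount x = k -> `|F x - l| <= B) -> `|up_average F k - l| <= B.
Proof.
move=> kN FB; have C0 : 0 < 'C(N, k)%:R :> R by rewrite ltr0n bin_gt0.
have -> : up_average F k - l = (\sum_(x | upcount x == k) (F x - l)) / 'C(N, k)%:R.
  rewrite big_split/= sumrN sumr_const card_upcount /up_average mulrBl.
  by rewrite -[l *+ _]mulr_natr mulfK// gt_eqF.
rewrite normrM [`|_^-1|]gtr0_norm ?invr_gt0// ler_pdivrMr//.
apply: (le_trans (ler_norm_sum _ _ _)).
apply: (le_trans (ler_sum _ (fun x xk => FB x (eqP xk)))).
by rewrite sumr_const card_upcount mulr_natr.
Qed.

Lemma cw_expect_lsum m N (F : {ffun 'I_N -> bool} -> R) : (0 < N)%N ->
  cw_expect F = lsum m N (up_average F) / lsum m N (fun=> 1).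
Proof.
move=> N0; rewrite cw_expectE (sum_cw_weight m)//.
have -> : \sum_(y : {ffun 'I_N -> bool}) cw_weight beta h p y =
    2 ^+ N * expR (N%:R * H m) * lsum m N (fun=> 1).
  under eq_bigr do rewrite -[cw_weight _ _ _ _]mulr1.
  rewrite (sum_cw_weight m)//; congr (_ * _); apply: eq_bigr => k _.
  by rewrite up_average1// -ltnS.
rewrite -mulf_div divff ?mul1r// mulf_neq0 ?expf_neq0// gt_eqF//.
exact: expR_gt0.
Qed.

End Expectation.

(* [- a] is the second derivative of [H] at [m]. *)
Definition laplace_point (R : realType) (H : R -> R) (m a c : R) : Prop :=
  [/\ -1 < m < 1, 0 < a, 0 < c,
   forall x, -1 <= x <= 1 -> H x <= H m - c * (x - m) ^+ 2 &
   forall e, 0 < e -> exists2 r, 0 < r & forall x, `|x - m| < r ->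
     `|H x - H m + a / 2 * (x - m) ^+ 2| <= e * (x - m) ^+ 2].

Section Laplace.
Variables (R : realType) (beta h : R) (p : nat) (kappa m a c : R).
Local Notation H := (Hfun beta h p).
Local Notation mu := (@lebesgue_measure R).
Local Notation v := (kappa ^+ 2 / a).
Hypothesis kappa0 : kappa != 0.
Hypothesis Hm : laplace_point H m a c.
Variables (F : forall N, {ffun 'I_N -> bool} -> R) (Psi : R -> R) (K : R) (A : set R).
Hypothesis mPsi : measurable_fun setT Psi.
Hypothesis A0 : mu.-negligible A.
Hypothesis F_K : forall N (x : {ffun 'I_N -> bool}), (0 < N)%N ->
  `|F x| <= K * expR (K * `|kappa * (Num.sqrt N%:R * (mag R x - m))|).
Hypothesis F_cvg : forall z, ~ A z -> forall e, 0 < e -> exists2 r, 0 < r &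
  \forall N \near \oo, forall x : {ffun 'I_N -> bool},
    `|kappa * (Num.sqrt N%:R * (mag R x - m)) - z| < r -> `|F x - Psi z| <= e.

(** Numerator and normalization are Laplace sums with the same constant [lnorm], the second with Psi
    = 1, so the constant cancels in the quotient. *)
Theorem laplace_expectation :
  (fun N => cw_expect beta h p (@F N)) @ \oo -->
  Rintegral mu setT (fun z => Psi z * gauss_pdf v z).
Proof.
have [m1 a0 c0 Hquad Hexp] := Hm.
have [cb cb0 stirling_cb] := stirling_cvg R.
have k2 : 0 < kappa ^+ 2 by rewrite exprn_even_gt0.
have v0 : 0 < v by rewrite divr_gt0.
have K0 : 0 <= K.
  have := le_trans (normr_ge0 _) (@F_K 1 [ffun=> true] isT).
  by rewrite pmulr_lge0// expR_gt0.
have num : (fun N => lsum beta h p m N (up_average (@F N))) @ \oo -->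
    lnorm kappa m a cb * Rintegral mu setT (fun z => Psi z * gauss_pdf v z).
  apply: (@laplace_sum _ H kappa m a c kappa0 m1 a0 c0 Hquad Hexp cb cb0 stirling_cb
    (fun N k => up_average (@F N) k) Psi K A mPsi A0 K0).
    move=> N k N0 kN; rewrite -[up_average _ _]subr0; apply: up_average_close => // x xk.
    by rewrite subr0; have := F_K x N0; rewrite mag_pts// xk.
  move=> z Az e e0; have [r r0 hr] := F_cvg Az e0; exists r => //.
  near=> N => k kN zk; apply: up_average_close => // x xk.
  have N0 : (0 < N)%N by near: N; exact: nbhs_infty_gt.
  have hN : forall x : {ffun 'I_N -> bool},
    `|kappa * (Num.sqrt N%:R * (mag R x - m)) - z| < r -> `|F x - Psi z| <= e.
    by near: N.
  by apply: hN; rewrite mag_pts// xk.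
have den : (fun N => lsum beta h p m N (fun=> 1)) @ \oo --> lnorm kappa m a cb.
  have -> : lnorm kappa m a cb =
      lnorm kappa m a cb * Rintegral mu setT (fun z => (cst 1 : R -> R) z * gauss_pdf v z).
    rewrite (_ : Rintegral _ _ _ = 1) ?mulr1//.
    rewrite /Rintegral; under eq_integral do rewrite mul1r.
    by rewrite integral_gauss_pdf.
  apply: (@laplace_sum _ H kappa m a c kappa0 m1 a0 c0 Hquad Hexp cb cb0 stirling_cb
    (fun _ _ => 1) (cst 1) 1 set0) => //.
  - exact: negligible_set0.
  - by move=> N k _ _; rewrite normr1 !mul1r -expR0 ler_expR.
  - by move=> z _ e e0; exists 1 => //; apply: nearW => N k _ _; rewrite subrr normr0 ltW.
have l0 : lnorm kappa m a cb != 0 by rewrite gt_eqF// lnorm_gt0.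
have q : lsum beta h p m N (up_average (@F N)) * (lsum beta h p m N (fun=> 1))^-1
    @[N --> \oo] -->
    lnorm kappa m a cb * Rintegral mu setT (fun z => Psi z * gauss_pdf v z) *
    (lnorm kappa m a cb)^-1.
  by apply: cvgM => //; exact: cvgV.
rewrite mulrAC divff ?mul1r// in q; apply: cvg_trans q; apply: near_eq_cvg.
near=> N; have N0 : (0 < N)%N by near: N; exact: nbhs_infty_gt.
by rewrite (cw_expect_lsum beta h p m).
Unshelve. all: by end_near. Qed.

End Laplace.

(** * Comparing the estimate with a given parameter *)

Section MeanMonotone.
Variables (R : realType) (h : R) (p N : nat).
Implicit Types (b t : R) (x : {ffun 'I_N -> bool}).
Hypothesis N0 : (0 < N)%N.
Local Notation mean b := (cw_mean_p b h p N).

Definition wsum b : R := \sum_(x : {ffun 'I_N -> bool}) cw_weight b h p x.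

Lemma wsum_gt0 b : 0 < wsum b. Proof. exact: cw_weight_sum_gt0. Qed.

Lemma cw_expect_tilt b b' :
  cw_expect b h p (fun x => expR ((b' - b) * N%:R * mag R x ^+ p)) = wsum b' / wsum b.
Proof.
rewrite cw_expectE; congr (_ / _); apply: eq_bigr => x _.
by rewrite /cw_weight -expRD; congr expR; ring.
Qed.

(* Jensen's inequality for E_b exp((b' - b) N X^p) = Z(b') / Z(b), obtained by
   integrating the tangent line of exp at the mean. *)
Lemma jensen_wsum b b' :
  expR ((b' - b) * N%:R * mean b) <= wsum b' / wsum b.
Proof.
rewrite -cw_expect_tilt; set d := (b' - b) * N%:R.
rewrite -[leLHS]mulr1 -(@cw_prob_sum1 _ b h p N) mulr_sumr -subr_ge0.
have E : \sum_(x : {ffun 'I_N -> bool}) cw_prob b h p x *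
    (expR (d * mean b) * (d * mag R x ^+ p - d * mean b)) = 0.
  rewrite (eq_bigr (fun x => expR (d * mean b) * d * (cw_prob b h p x * mag R x ^+ p)
     - expR (d * mean b) * d * mean b * cw_prob b h p x)); last by move=> x _; ring.
  rewrite big_split/= sumrN -!mulr_sumr cw_prob_sum1 -/(mean b).
  by rewrite mulr1 subrr.
rewrite -[leLHS]E /cw_expect -sumrB; apply: ler_sum => x _.
rewrite [leRHS](_ : _ = cw_prob b h p x *
    (expR (d * mean b) * (expR (d * mag R x ^+ p - d * mean b) - 1))); last first.
  by rewrite expRB; field; rewrite gt_eqF ?expR_gt0.
rewrite ler_wpM2l ?cw_prob_ge0// ler_wpM2l ?expR_ge0//.
by rewrite lerBrDl expR_ge1Dx.
Qed.

(** Multiplying Jensen's inequalities from b to b' and back cancels the partition functions and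
    leaves exp((b' - b) N (mean b - mean b')) <= 1. *)
Lemma cw_mean_p_mono b b' : b <= b' -> mean b <= mean b'.
Proof.
rewrite le_eqVlt => /predU1P[->//|bb'].
have J1 := jensen_wsum b b'; have J2 := jensen_wsum b' b.
have : expR ((b' - b) * N%:R * mean b) * expR ((b - b') * N%:R * mean b') <= 1.
  apply: (le_trans (ler_pM (expR_ge0 _) (expR_ge0 _) J1 J2)).
  by rewrite mulf_div [wsum b * _]mulrC divff// mulf_neq0// gt_eqF// wsum_gt0.
rewrite -expRD expR_le1 -(opprB b' b) !mulNr -mulrBr pmulr_rle0 ?subr_le0//.
by rewrite mulr_gt0 ?subr_gt0// ltr0n.
Qed.

(** Strictness of the inequality is what excludes the estimate +oo as well as a finite one above
    [b1]. *)
Lemma mle_le x (b : \bar R) b1 : is_mle h p x b -> mag R x ^+ p < mean b1 ->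
  (b <= b1%:E)%E.
Proof.
case: b => [b| |]/=; rewrite ?leNye//.
- move=> E lt; rewrite lee_fin leNgt; apply/negP => /ltW/cw_mean_p_mono.
  by rewrite E leNgt lt.
- by move=> /(_ b1); rewrite leNgt => /negP.
Qed.

Lemma mle_ge x (b : \bar R) b1 : is_mle h p x b -> mean b1 < mag R x ^+ p ->
  (b1%:E <= b)%E.
Proof.
case: b => [b| |]/=; rewrite ?leey//.
- move=> E lt; rewrite lee_fin leNgt; apply/negP => /ltW/cw_mean_p_mono.
  by rewrite E leNgt lt.
- by move=> /(_ b1); rewrite leNgt => /negP.
Qed.

Variables (beta l : R).

Definition mgf t : R :=
  cw_expect beta h p (fun x => expR (t * (Num.sqrt N%:R * (mag R x ^+ p - l)))).

Lemma mgfE t : mgf t = expR (- (t * Num.sqrt N%:R * l)) *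
  (wsum (beta + t / Num.sqrt N%:R) / wsum beta).
Proof.
have s0 := sqrtN_gt0 R N0.
rewrite -cw_expect_tilt /cw_expect mulr_sumr; apply: eq_bigr => x _.
rewrite [RHS]mulrCA -expRD; congr (_ * expR _).
move: (sqrt_natE R N) s0; move: (N%:R) (Num.sqrt _) => n s -> s0.
by field; lra.
Qed.

(** Convexity of log [mgf]: the scaled mean at beta + t1 / sqrt N is its slope at t1, compared with
    the secant from t1 to t2 without differentiating. *)
Lemma jensen_mgf t1 t2 :
  expR ((t2 - t1) * (Num.sqrt N%:R * (mean (beta + t1 / Num.sqrt N%:R) - l))) <=
  mgf t2 / mgf t1.
Proof.
have s0 := sqrtN_gt0 R N0.
have := jensen_wsum (beta + t1 / Num.sqrt N%:R) (beta + t2 / Num.sqrt N%:R).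
set e := mean _ => J.
have -> : mgf t2 / mgf t1 = expR (- ((t2 - t1) * Num.sqrt N%:R * l)) *
    (wsum (beta + t2 / Num.sqrt N%:R) / wsum (beta + t1 / Num.sqrt N%:R)).
  have -> : - ((t2 - t1) * Num.sqrt N%:R * l) =
    - (t2 * Num.sqrt N%:R * l) - (- (t1 * Num.sqrt N%:R * l)) by ring.
  rewrite !mgfE expRB.
  have := wsum_gt0 (beta + t1 / Num.sqrt N%:R); have := wsum_gt0 beta.
  have := expR_gt0 (- (t1 * Num.sqrt N%:R * l)).
  move: (expR _) (expR _) (wsum _) (wsum _) (wsum _) => a1 a2 a3 a4 a5 h1 h2 h3.
  by field; rewrite !gt_eqF.
apply: le_trans (ler_wpM2l (expR_ge0 _) J); rewrite -expRD.
rewrite le_eqVlt; apply/orP; left; apply/eqP; congr expR.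
move: (e) (sqrt_natE R N) s0; move: (N%:R) (Num.sqrt _) => n s e' -> s0.
by field; lra.
Qed.

End MeanMonotone.

(** * Exponential growth of the partition function where the energy is positive *)

Section MeanAway.
Variables (R : realType) (p : nat).
Implicit Types (b x : R) (N : nat).

(** A crude bound uniform in k, good enough against exponential growth. In the interior two Stirling
    ratios are at least e^-1 and the third is at most 1; at the endpoints [bincorr] is 1. *)
Lemma bincorr_lower N k : (0 < N)%N -> (k <= N)%N ->
  expR (- 2) / N%:R <= bincorr R N k.
Proof.
move=> N0 kN; have Np : 0 < N%:R :> R by rewrite ltr0n.
have N1 : 1 <= N%:R :> R by rewrite ler1n.
have e0 : 0 < expR (-2) :> R := expR_gt0 _.
have e1 : expR (-2) <= 1 :> R by rewrite expR_le1; lra.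
have endpt : (k = 0)%N \/ k = N -> expR (- 2) / N%:R <= bincorr R N k.
  move=> kE; have -> : bincorr R N k = 1.
    rewrite bincorrE//; case: kE => ->.
      by rewrite bin0 subn0 expr0 divff ?gt_eqF// expr1n !mul1r.
    by rewrite binn subnn expr0 divff ?gt_eqF// expr1n !mulr1.
  by rewrite ler_pdivrMr// mul1r (le_trans e1).
have [k0|k0] := posnP k; first by apply: endpt; left.
have [kE|kN'] := eqVneq k N; first by apply: endpt; right.
have {kN'}kN' : (k < N)%N by rewrite ltn_neqAle kN' kN.
have s0 := sqrtN_gt0 R N0.
have sN : Num.sqrt N%:R <= N%:R :> R.
  rewrite [leRHS]sqrt_natE expr2 ler_peMr ?(ltW s0)//.
  by rewrite -[leLHS]sqrtr1 ler_wsqrtr.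
rewrite ler_pdivrMr// (@le_trans _ _ (Num.sqrt N%:R * bincorr R N k))//; last first.
  by rewrite mulrC ler_wpM2l ?bincorr_ge0.
rewrite sqrtN_bincorrE ?k0//.
have /andP[b1 b2] := stirling_bounds R k0.
have /andP[b3 b4] : expR (-1) <= stirling R (N - k) <= 1.
    by apply: stirling_bounds; rewrite subn_gt0.
have /andP[b5 b6] := stirling_bounds R N0.
have e10 := expR_gt0 (-1 : R).
have x2 : 0 < 1 - pts R N k ^+ 2.
  have -> : 1 - pts R N k ^+ 2 = (1 - pts R N k) * (1 + pts R N k) by ring.
  rewrite pts1B// ptsD1 mulr_gt0// divr_gt0// mulr_gt0// ltr0n//.
  by rewrite subn_gt0.
rewrite -[leLHS]mulr1; apply: ler_pM => //.
  have -> : expR (-2) = expR (-1) * expR (-1) * 1 :> R by rewrite mulr1 -expRD; congr expR; lra.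
  apply: ler_pM => //; rewrite ?mulr_ge0 ?(ltW e10)//.
    by apply: ler_pM; rewrite ?(ltW e10).
  by rewrite invf_ge1// (lt_le_trans e10).
rewrite ler_pdivlMr ?sqrtr_gt0// mul1r.
rewrite (@le_trans _ _ 1)//; last by lra.
by rewrite -[leRHS]sqrtr1 ler_wsqrtr// gerBl sqr_ge0.
Qed.

(** A single term suffices, at the grid point just below x. Continuity costs half of the energy e,
    and another quarter beats the factor e^-2 / N of [bincorr_lower]. *)
Lemma wsum_growth b x : -1 <= x <= 1 -> 0 < Hfun b 0 p x ->
  exists2 eta, 0 < eta & \forall N \near \oo,
    2 ^+ N * expR (N%:R * eta) <= wsum 0 p N b.
Proof.
move=> /andP[x1 x2] Hx; set e := Hfun b 0 p x in Hx *.
have e2 : 0 < e / 2 by rewrite divr_gt0.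
have /cvgrPdist_le/(_ _ e2)[r /= r0 hr] := @continuous_Hfun R b 0 p x.
exists (e / 4); first by rewrite divr_gt0.
near=> N.
have N0 : (0 < N)%N by near: N; exact: nbhs_infty_gt.
have Np : 0 < N%:R :> R by rewrite ltr0n.
pose k := Num.truncn (N%:R * (1 + x) / 2).
have /truncn_itv/andP[k1 k2] : 0 <= N%:R * (1 + x) / 2 by rewrite divr_ge0// mulr_ge0//; lra.
have kN : (k <= N)%N by rewrite -(ler_nat R) (le_trans k1)// ler_pdivrMr// ler_wpM2l//; lra.
have kx : `|x - pts R N k| < r.
  have : 2 / N%:R < r.
    rewrite ltr_pdivrMr// mulrC -ltr_pdivrMr//.
    by near: N; exact: nbhs_infty_gtr.
  have -> : x - pts R N k = (N%:R * (1 + x) / 2 - k%:R) * (2 / N%:R).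
    by rewrite /pts; field; lra.
  apply: le_lt_trans; rewrite ger0_norm.
    by rewrite ler_piMl ?divr_ge0//; move: k2; rewrite -natr1 -/k; lra.
  by rewrite mulr_ge0 ?divr_ge0// subr_ge0.
have := hr _ kx; rewrite -/e ler_norml => /andP[_ He].
have -> : wsum 0 p N b = 2 ^+ N * expR (N%:R * Hfun b 0 p x) * lsum b 0 p x N (fun=> 1).
  rewrite /wsum; under eq_bigr do rewrite -[cw_weight _ _ _ _]mulr1.
  rewrite (sum_cw_weight _ _ _ x)//; congr (_ * _); apply: eq_bigr => j _.
  by rewrite up_average1// -ltnS.
rewrite -mulrA ler_wpM2l ?exprn_ge0//.
rewrite /lsum (bigD1 (Ordinal (kN : (k < N.+1)%N)))//= mul1r.
rewrite mulrDr ler_wpDr//.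
  rewrite mulr_ge0 ?expR_ge0//; apply: sumr_ge0 => j _.
  by rewrite mul1r mulr_ge0 ?bincorr_ge0 ?expR_ge0.
rewrite [leRHS]mulrCA -expRD -mulrDr (addrC (Hfun _ _ _ x)) subrK.
apply: (@le_trans _ _ (expR (- 2) / N%:R * expR (N%:R * (e / 2)))); last first.
  apply: ler_pM; rewrite ?expR_ge0 ?divr_ge0 ?expR_ge0 ?bincorr_lower//.
  by rewrite ler_expR ler_wpM2l//; lra.
have -> : N%:R * (e / 2) = N%:R * (e / 4) + N%:R * (e / 4) by field.
rewrite expRD mulrA ler_peMl ?expR_ge0// -mulrA -ler_pdivrMl ?expR_gt0// mulr1.
rewrite -expRN opprK ler_pdivlMl//.
have -> : N%:R * (e / 4) = N%:R * (e / 8) + N%:R * (e / 8) by field.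
rewrite [expR (_ * _ + _)]expRD.
(* The square of u <= expR u at u = N e / 8 dominates [N * expR 2] once N >= 64 [expR 2] / e^2. *)
apply: (@le_trans _ _ ((N%:R * (e / 8)) * (N%:R * (e / 8)))).
  have e20 : 0 < 64 / e ^+ 2 by rewrite divr_gt0// exprn_gt0.
  rewrite -mulrA ler_wpM2l//.
  have -> : e / 8 * (N%:R * (e / 8)) = N%:R / (64 / e ^+ 2) by field; rewrite gt_eqF.
  by rewrite ler_pdivlMr//; near: N; exact: nbhs_infty_ger.
have hE : N%:R * (e / 8) <= expR (N%:R * (e / 8)).
  by apply: le_trans (expR_ge1Dx _); rewrite lerDr.
by apply: ler_pM => //; rewrite mulr_ge0// divr_ge0// ltW.
Unshelve. all: by end_near. Qed.

(** The partition sum at 0 is exactly 2^N, so Jensen from b to 0 gives exp(- b N E_b X^p) <= exp(- N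
    eta). The sign of b is free, which serves negative b when p is odd. *)
Lemma mean_away b x : -1 <= x <= 1 -> 0 < Hfun b 0 p x ->
  exists2 eta, 0 < eta & \forall N \near \oo, eta <= b * cw_mean_p b 0 p N.
Proof.
move=> x1 Hx; have [eta eta0 he] := wsum_growth x1 Hx.
exists eta => //; near=> N.
have N0 : (0 < N)%N by near: N; exact: nbhs_infty_gt.
have Np : 0 < N%:R :> R by rewrite ltr0n.
have hN : 2 ^+ N * expR (N%:R * eta) <= wsum 0 p N b by near: N.
have w0 : wsum 0 p N 0 = 2 ^+ N :> R.
  rewrite /wsum (eq_bigr (fun=> 1)); last first.
    by move=> y _; rewrite /cw_weight !mul0r addr0 mulr0 expR0.
  rewrite sumr_const card_ffun card_bool card_ord -natrX.
  by [].
have := @jensen_wsum R 0 p N b 0; rewrite w0 sub0r => J.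
have : expR (- b * N%:R * cw_mean_p b 0 p N) <= expR (- (N%:R * eta)).
  apply: (le_trans J); rewrite ler_pdivrMr ?wsum_gt0// expRN.
  by rewrite mulrC ler_pdivlMr ?expR_gt0.
rewrite ler_expR !mulNr lerN2 => hE.
by rewrite -(ler_pM2l Np) [leRHS]mulrCA mulrA.
Unshelve. all: by end_near. Qed.

End MeanAway.

(** * The critical parameter and the regular points *)

Section CriticalPoint.
Variables (R : realType) (p : nat).
Hypothesis p3 : (3 <= p)%N.
Implicit Types (b x : R).
Local Notation T := (tilde_beta R p).

Let p0 : (0 < p)%N. Proof. exact: leq_trans p3. Qed.

Definition nonpositive_energy b :=
  forall x : R, -1 <= x <= 1 -> Hfun b 0 p x <= 0.

Lemma Ient_ge0 x : -1 <= x <= 1 -> 0 <= Ient x.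
Proof. by move=> /Ient_ge; apply: le_trans; rewrite divr_ge0 ?sqr_ge0. Qed.

Lemma Hfun_at0 b h : Hfun b h p 0 = 0.
Proof. by rewrite /Hfun expr0n gtn_eqF// !mulr0 Ient0 addr0 subr0. Qed.

Lemma energy_le b x : -1 <= x <= 1 -> Hfun b 0 p x <= `|b|.
Proof.
move=> x1; rewrite /Hfun mul0r addr0 lerBlDr (@le_trans _ _ `|b|)//.
  apply: (le_trans (ler_norm _)); rewrite normrM normrX ler_piMr//.
  by rewrite exprn_ile1// ler_norml.
by rewrite lerDl Ient_ge0.
Qed.

Lemma has_sup_energy b :
  has_sup [set y | exists2 x : R, -1 <= x <= 1 & y = Hfun b 0 p x].
Proof.
split; first by exists (Hfun b 0 p 0); exists 0 => //; lra.
by exists `|b| => _ [x x1 ->]; exact: energy_le.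
Qed.

(** The energy vanishes at 0, so its supremum is never negative. *)
Lemma sup_energy_eq0 b :
  sup [set y | exists2 x : R, -1 <= x <= 1 & y = Hfun b 0 p x] = 0 <->
  nonpositive_energy b.
Proof.
split=> [E x x1|nb].
  by rewrite -[leRHS]E; apply: sup_ubound; [exact: (has_sup_energy b).2|exists x].
apply/eqP; rewrite eq_le; apply/andP; split.
  by apply: ge_sup; [exact: (has_sup_energy b).1|move=> _ [x x1 ->]; exact: nb].
rewrite -[leLHS](Hfun_at0 b 0); apply: sup_ubound; first exact: (has_sup_energy b).2.
by exists 0 => //; lra.
Qed.

Let S := [set b : R | 0 <= b /\
  sup [set y | exists2 x : R, -1 <= x <= 1 & y = Hfun b 0 p x] = 0].

Let has_sup_S : has_sup S.
Proof.
split.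
  exists 0; split => //; apply/sup_energy_eq0 => x x1.
  by rewrite /Hfun !mul0r addr0 sub0r oppr_le0 Ient_ge0.
(* At x = 1 the energy is b - ln 2. *)
exists (ln 2) => b [b0 /sup_energy_eq0/(_ 1)].
rewrite /Hfun mul0r addr0 Ient1 expr1n mulr1 subr_le0; apply.
by rewrite lexx andbT; lra.
Qed.

Lemma tilde_beta_ub b : 0 <= b -> nonpositive_energy b -> b <= T.
Proof.
move=> b0 nb; apply: sup_ubound; first exact: has_sup_S.2.
by split => //; apply/sup_energy_eq0.
Qed.

Lemma tilde_beta_ge0 : 0 <= T.
Proof.
apply: tilde_beta_ub => // x x1.
by rewrite /Hfun !mul0r addr0 sub0r oppr_le0 Ient_ge0.
Qed.

Lemma below_tilde_beta b : b < T ->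
  exists b', [/\ b < b', 0 <= b' & nonpositive_energy b'].
Proof.
move=> bT; have e0 : 0 < T - b by rewrite subr_gt0.
have [b' [b'0 /sup_energy_eq0 nb'] hb'] := sup_adherent e0 has_sup_S.
by exists b'; split => //; move: hb'; rewrite opprB addrC subrK.
Qed.

Lemma above_tilde_beta b : T < b -> exists2 x, -1 <= x <= 1 & 0 < Hfun b 0 p x.
Proof.
move=> Tb; apply: contrapT => no.
have : b <= T.
  apply: tilde_beta_ub; first exact: le_trans tilde_beta_ge0 (ltW Tb).
  by move=> x x1; rewrite leNgt; apply/negP => Hx; apply: no; exists x.
by rewrite leNgt Tb.
Qed.

Lemma dHfun0 b h : dHfun b h p 0 = h.
Proof.
rewrite /dHfun expr0n; case: p p3 => [|[|q]]//= _.
by rewrite !mulr0 add0r addr0 subr0 subrr mul0r subr0.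
Qed.

Lemma d2Hfun0 b : d2Hfun b p 0 = -1.
Proof.
rewrite /d2Hfun !expr0n; case: p p3 => [|[|[|q]]]//= _.
by rewrite !mulr0 subr0 invr1 sub0r.
Qed.

(** Take b' > B with b' |x|^p <= I(x). Then b x^p <= (B/b') I(x), so the energy is at most - (1 -
    B/b') I(x) <= - (1 - B/b') x^2 / 2. The comparison through B covers |b| < T for every p, and
    negative b for even p with B = 0. *)
Lemma laplace_point_subcritical b B : 0 <= B < T ->
  (forall x, b * x ^+ p <= B * `|x| ^+ p) ->
  exists c, laplace_point (Hfun b 0 p) 0 1 c.
Proof.
move=> /andP[B0 BT] bB; have [b' [Bb' b'0 nb']] := below_tilde_beta BT.
have b'p : 0 < b' by exact: le_lt_trans Bb'.
have t1 : B / b' < 1 by rewrite ltr_pdivrMr// mul1r.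
have t0 : 0 <= B / b' by rewrite divr_ge0.
have c0 : 0 < (1 - B / b') / 2 by lra.
exists ((1 - B / b') / 2); split => //; first by lra.
  move=> x x1; rewrite subr0 Hfun_at0 sub0r /Hfun mul0r addr0.
  have ax : -1 <= `|x| <= 1 by rewrite ler_norml x1 andbT (le_trans _ (normr_ge0 _))//; lra.
  have Ix : Ient `|x| = Ient x.
    by have [//|_] := ger0P x; rewrite IentN.
  have := nb' _ ax; rewrite /Hfun mul0r addr0 Ix subr_le0 => h1.
  have h2 : B * `|x| ^+ p <= B / b' * Ient x.
    rewrite -[leLHS](_ : B / b' * (b' * `|x| ^+ p) = _) ?ler_wpM2l//.
    by field; rewrite gt_eqF.
  have := bB x; have := Ient_ge x1; nra.
move=> e e0; have m1 : -1 < (0 : R) < 1 by rewrite ltrN10 ltr01.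
have [r r0 hr] := @Hfun_expansion R b 0 p 0 e m1 (dHfun0 _ _) e0.
exists r => // x xr; have := hr x xr; rewrite d2Hfun0.
by rewrite mulN1r mulNr opprK mul1r.
Qed.

Section Regular.
Variables (beta h m : R).
Hypothesis reg : p_regular p beta h.
Hypothesis gm : is_gmax beta h p m.

Lemma p_regular_unique : forall m', is_gmax beta h p m' <-> m' = m.
Proof. by have [m' [um' _]] := reg; rewrite ((um' m).1 gm). Qed.

Lemma p_regular_interior : -1 < m < 1.
Proof. by have [m' [um' [m1 _]]] := reg; rewrite ((um' m).1 gm). Qed.

Lemma p_regular_H2 : H2 beta h p m < 0.
Proof. by have [m' [um' [_ ?]]] := reg; rewrite ((um' m).1 gm). Qed.

Lemma p_regular_laplace_point :
  exists c, laplace_point (Hfun beta h p) m (- H2 beta h p m) c.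
Proof.
have m1 := p_regular_interior; have H20 := p_regular_H2.
have d20 : d2Hfun beta p m < 0 by rewrite -(H2E _ h)//.
have [c c0 hc] := Hfun_quadratic_bound p_regular_unique m1 d20.
exists c; split => //; first by rewrite oppr_gt0.
move=> e e0; have [r r0 hr] := Hfun_expansion m1 (dHfun_gmax m1 gm) e0.
exists r => // x xr; have := hr x xr.
by rewrite H2E// mulNr mulNr.
Qed.

Lemma gmax0_iff : 0 <= beta -> m = 0 <-> h = 0 /\ beta < T.
Proof.
move=> beta0; split=> [E|[h0 bT]]; last first.
  have [|x|c [_ _ c0 hc _]] := @laplace_point_subcritical beta beta; first by rewrite beta0.
    by rewrite ler_wpM2l// -normrX ler_norm.
  symmetry; apply/p_regular_unique; rewrite h0; split; first by lra.
  move=> x x1; apply: (le_trans (hc x x1)).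
  by rewrite gerBl mulr_ge0 ?sqr_ge0 ?ltW.
have [c [m1 _ c0 hc _]] := p_regular_laplace_point.
have h0 : h = 0 by have := dHfun_gmax m1 gm; rewrite E dHfun0.
(* The bound H(x) <= - c x^2 leaves room to raise beta by c, since x^p <= x^2 on [-1, 1]. *)
split => //; apply: (@lt_le_trans _ _ (beta + c)); first by rewrite ltrDl.
apply: tilde_beta_ub; first by rewrite addr_ge0 ?(ltW c0).
move=> x x1; have := hc x x1; rewrite E h0 Hfun_at0 subr0 sub0r.
have -> : Hfun (beta + c) 0 p x = Hfun beta 0 p x + c * x ^+ p by rewrite /Hfun; ring.
have ax : `|x| <= 1 by rewrite ler_norml.
have : c * x ^+ p <= c * x ^+ 2.
  rewrite ler_pM2l// (le_trans (ler_norm _))// normrX -[x ^+ 2]ger0_norm ?sqr_ge0//.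
  by rewrite normrX ler_wiXn2l// ltnW.
by lra.
Qed.

End Regular.
End CriticalPoint.

(** * Fluctuations around a nonzero maximizer *)

Section Fluctuations.
Variables (R : realType) (beta h : R) (p : nat) (m a c : R).
Local Notation H := (Hfun beta h p).
Local Notation mu := (@lebesgue_measure R).
Hypothesis p0 : (0 < p)%N.
Hypothesis m0 : m != 0.
Hypothesis Hm : laplace_point H m a c.
(* With this [kappa], an estimate based on a configuration whose scaled
   coordinate [kappa * sqrt N * (x - m)] is close to [z] is itself close to
   [beta + z / sqrt N]. *)
Local Notation kappa := (a / (p%:R * m ^+ p.-1)).
Local Notation v := (kappa ^+ 2 / a).
Local Notation zx N x := (kappa * (Num.sqrt N%:R * (mag R x - m))).

Let a0 : 0 < a. Proof. by case: Hm. Qed.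

Let m1 : -1 < m < 1. Proof. by case: Hm. Qed.

Lemma pm_neq0 : p%:R * m ^+ p.-1 != 0.
Proof. by rewrite mulf_neq0 ?expf_neq0// pnatr_eq0 -lt0n. Qed.

Lemma kappa_neq0 : kappa != 0.
Proof. by rewrite mulf_neq0 ?invr_eq0 ?pm_neq0// gt_eqF. Qed.

Lemma v_gt0 : 0 < v.
Proof. by rewrite divr_gt0// exprn_even_gt0// kappa_neq0. Qed.

(** The identity that dictates [kappa]: the linear part of sqrt N (X^p - m^p) becomes z / v, the
    slope at z of the limiting t^2 / (2 v). *)
Lemma pm_kappa : p%:R * m ^+ p.-1 / kappa = v^-1.
Proof.
have q0 := pm_neq0; move: q0; set q := p%:R * _ => q0.
by field; rewrite q0 gt_eqF.
Qed.

Lemma exprn_lipschitz (x y : R) n : `|x| <= 1 -> `|y| <= 1 ->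
  `|x ^+ n - y ^+ n| <= n%:R * `|x - y|.
Proof.
move=> x1 y1; elim: n => [|n IH]; first by rewrite !expr0 subrr normr0 mul0r.
have -> : x ^+ n.+1 - y ^+ n.+1 = x * (x ^+ n - y ^+ n) + (x - y) * y ^+ n.
  by rewrite !exprS; ring.
apply: (le_trans (ler_normD _ _)); rewrite !normrM -natr1 mulrDl mul1r lerD//.
  by apply: le_trans IH; rewrite ler_piMl.
by rewrite ler_piMr// normrX exprn_ile1.
Qed.

Lemma mag_norm_le1 N (x : {ffun 'I_N -> bool}) : (0 < N)%N -> `|mag R x| <= 1.
Proof. by move=> N0; rewrite mag_pts// ler_norml pts_itv// upcount_le. Qed.

Lemma sqrtN_power_bound N (x : {ffun 'I_N -> bool}) : (0 < N)%N ->
  `|Num.sqrt N%:R * (mag R x ^+ p - m ^+ p)| <= p%:R / `|kappa| * `|zx N x|.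
Proof.
move=> N0; have k0 : 0 < `|kappa| by rewrite normr_gt0 kappa_neq0.
have s0 := sqrtN_gt0 R N0.
rewrite (normrM kappa) mulrA divfK ?gt_eqF// !normrM [leRHS]mulrCA ler_wpM2l//.
apply: exprn_lipschitz; first exact: mag_norm_le1.
by have /andP[? ?] := m1; rewrite ler_norml; lra.
Qed.

(** The delta method. [e1] is chosen so that the remainder of the linearization contributes e/2 when
    |z_N| <= |z| + 1; the other e/2 comes from z_N - z. *)
Lemma sqrtN_power_close z e : 0 < e -> exists2 r, 0 < r &
  \forall N \near \oo, forall x : {ffun 'I_N -> bool}, `|zx N x - z| < r ->
    `|Num.sqrt N%:R * (mag R x ^+ p - m ^+ p) - z / v| <= e.
Proof.
move=> e0; have k0 : 0 < `|kappa| by rewrite normr_gt0 kappa_neq0.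
have v0 := v_gt0.
pose e1 := e / 2 * `|kappa| / (`|z| + 1).
have z1 : 0 < `|z| + 1 by rewrite ltr_wpDl.
have e10 : 0 < e1 by rewrite divr_gt0// mulr_gt0// divr_gt0.
have [r r0 hr] := is_derive_eps (is_deriveX_nat p m) e10.
exists (Num.min 1 (e / 2 * v)); first by rewrite lt_min ltr01 mulr_gt0// divr_gt0.
near=> N => x; rewrite lt_min => /andP[xz1 xz2].
have N0 : (0 < N)%N by near: N; exact: nbhs_infty_gt.
have s0 := sqrtN_gt0 R N0.
have zb : `|zx N x| <= `|z| + 1.
  rewrite -[zx N x](subrK z) (le_trans (ler_normD _ _))// addrC lerD2l.
  exact: ltW.
have E : `|zx N x| = `|kappa| * (Num.sqrt N%:R * `|mag R x - m|).
  by rewrite !normrM (gtr0_norm s0).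
have xm : `|mag R x - m| < r.
  have h1 : `|mag R x - m| <= (`|z| + 1) / `|kappa| / Num.sqrt N%:R.
    by rewrite ler_pdivlMr// ler_pdivlMr// -[leLHS](_ : `|zx N x| = _)// E; ring.
  apply: (le_lt_trans h1); apply: (le_lt_trans (ler_norm _)).
  near: N; have /cvgrPdist_lt/(_ _ r0) := cvg_sqrt_nat_inv ((`|z| + 1) / `|kappa|).
  by apply: filterS => N; rewrite sub0r normrN.
have := hr _ xm => h1.
have -> : Num.sqrt N%:R * (mag R x ^+ p - m ^+ p) - z / v =
    Num.sqrt N%:R * (mag R x ^+ p - m ^+ p - p%:R * m ^+ p.-1 * (mag R x - m)) +
    (zx N x - z) / v.
  rewrite -pm_kappa; have q0 := pm_neq0; move: q0; set q := p%:R * _ => q0.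
  by field; rewrite q0 gt_eqF.
apply: (le_trans (ler_normD _ _)); rewrite -[leRHS](@subrK _ (e / 2)).
have -> : e - e / 2 = e / 2 by field.
apply: lerD.
  rewrite normrM (gtr0_norm s0).
  apply: (@le_trans _ _ (Num.sqrt N%:R * (e1 * `|mag R x - m|))); first by rewrite ler_wpM2l// ltW.
  have -> : Num.sqrt N%:R * (e1 * `|mag R x - m|) = e / 2 * (`|zx N x| / (`|z| + 1)).
    by rewrite E /e1; field; rewrite gt_eqF.
  by rewrite ger_pMr ?divr_gt0// ler_pdivrMr// mul1r.
by rewrite normrM normfV (gtr0_norm v0) ler_pdivrMr// ltW.
Unshelve. all: by end_near. Qed.

Lemma gauss_mgf t :
  Rintegral mu setT (fun z => expR (t * (z / v)) * gauss_pdf v z) =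
  expR (t ^+ 2 / (2 * v)).
Proof.
have v0 := v_gt0; have s0 : 0 < Num.sqrt v by rewrite sqrtr_gt0.
rewrite /Rintegral; under eq_integral => z _.
  (* Completing the square: t z / v - z^2 / (2v) = t^2 / (2v) - (z - t)^2 / (2v). *)
  rewrite (_ : expR _ * _ = expR (t ^+ 2 / (2 * v)) * normal_pdf t (Num.sqrt v) z).
    by rewrite EFinM; over.
  rewrite gauss_pdfE// !normal_pdfE ?gt_eqF// /normal_fun sqr_sqrtr ?ltW// subr0.
  rewrite mulrCA [RHS]mulrCA -!expRD; congr (_ * expR _).
  by rewrite -[v *+ 2]mulr_natl; move: v v0 => w w0; field; rewrite gt_eqF.
rewrite integralZl//; last exact: integrable_normal_pdf.
by rewrite integral_normal_pdf mule1.
Qed.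

Lemma mgf_cvg t : mgf h p N beta (m ^+ p) t @[N --> \oo] --> expR (t ^+ 2 / (2 * v)).
Proof.
have k0 := kappa_neq0; have v0 := v_gt0.
rewrite -gauss_mgf.
pose K := 1 + `|t| * (p%:R / `|kappa|).
have K1 : 1 <= K by rewrite lerDl mulr_ge0// divr_ge0.
apply: (@laplace_expectation R beta h p kappa m a c k0 Hm
  (fun N x => expR (t * (Num.sqrt N%:R * (mag R x ^+ p - m ^+ p))))
  (fun z => expR (t * (z / v))) K set0).
- apply: continuous_measurable_fun => z.
  apply: (@continuous_comp _ _ _ (fun z : R => t * (z / v)) (@expR R)); last exact: continuous_expR.
  apply: cvgM; first exact: cvg_cst.
  by apply: cvgM; [exact: cvg_id|exact: cvg_cst].
- exact: negligible_set0.
- move=> N x N0; rewrite ger0_norm ?expR_ge0//.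
  apply: (@le_trans _ _ (expR (K * `|zx N x|))); last by rewrite ler_peMl ?expR_ge0.
  rewrite ler_expR (le_trans (ler_norm _))// normrM /K mulrDl mul1r.
  rewrite ler_wpDl// -mulrA ler_wpM2l//.
  exact: sqrtN_power_bound.
- move=> z _ e e0.
  have ce : {for z / v, continuous (fun y : R => expR (t * y))}.
    apply: (@continuous_comp _ _ _ (fun y : R => t * y) (@expR R)); last exact: continuous_expR.
    by apply: cvgM; [exact: cvg_cst|exact: cvg_id].
  have /cvgrPdist_le/(_ _ e0)[d /= d0 hd] := ce.
  have d20 : 0 < d / 2 by rewrite divr_gt0.
  have [r r0 hr] := sqrtN_power_close z d20; exists r => //.
  apply: filterS hr => N hN x /hN h1; rewrite distrC; apply: hd => /=.
  by rewrite distrC (le_lt_trans h1)// ltr_pdivrMr// ltr_pMr// ltr1n.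
Qed.

(** (t1 + t2) / (2v) is the secant slope of t^2 / (2v) between t1 and t2; t2 is an auxiliary point
    to the right of t1, and to its left in the companion lower bound. *)
Lemma scaled_mean_lt t1 t2 w : t1 < t2 -> (t1 + t2) / (2 * v) < w ->
  \forall N \near \oo,
    Num.sqrt N%:R * (cw_mean_p (beta + t1 / Num.sqrt N%:R) h p N - m ^+ p) < w.
Proof.
move=> t12 hw; have v0 := v_gt0.
have q : mgf h p N beta (m ^+ p) t2 * (mgf h p N beta (m ^+ p) t1)^-1 @[N --> \oo] -->
    expR (t2 ^+ 2 / (2 * v)) * (expR (t1 ^+ 2 / (2 * v)))^-1.
  apply: cvgM; first exact: mgf_cvg.
  by apply: cvgV; [rewrite gt_eqF ?expR_gt0|exact: mgf_cvg].
have lt : expR (t2 ^+ 2 / (2 * v)) * (expR (t1 ^+ 2 / (2 * v)))^-1 < expR ((t2 - t1) * w).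
  rewrite -expRB ltr_expR.
  have -> : t2 ^+ 2 / (2 * v) - t1 ^+ 2 / (2 * v) = (t2 - t1) * ((t1 + t2) / (2 * v)).
    by move: v v0 => u u0; field; rewrite gt_eqF.
  by rewrite ltr_pM2l ?subr_gt0.
have : \forall N \near \oo, mgf h p N beta (m ^+ p) t2 / mgf h p N beta (m ^+ p) t1 <
    expR ((t2 - t1) * w) by apply: (cvgr_lt _ q).
apply: filter_app; near=> N => hlt.
have N0 : (0 < N)%N by near: N; exact: nbhs_infty_gt.
rewrite -(@ltr_pM2l _ (t2 - t1)) ?subr_gt0// -ltr_expR.
exact: le_lt_trans (jensen_mgf _ _ N0 _ _ _ _) hlt.
Unshelve. all: by end_near. Qed.

Lemma scaled_mean_gt t1 t2 w : t2 < t1 -> w < (t1 + t2) / (2 * v) ->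
  \forall N \near \oo,
    w < Num.sqrt N%:R * (cw_mean_p (beta + t1 / Num.sqrt N%:R) h p N - m ^+ p).
Proof.
move=> t12 hw; have v0 := v_gt0.
have q : mgf h p N beta (m ^+ p) t2 * (mgf h p N beta (m ^+ p) t1)^-1 @[N --> \oo] -->
    expR (t2 ^+ 2 / (2 * v)) * (expR (t1 ^+ 2 / (2 * v)))^-1.
  apply: cvgM; first exact: mgf_cvg.
  by apply: cvgV; [rewrite gt_eqF ?expR_gt0|exact: mgf_cvg].
have lt : expR (t2 ^+ 2 / (2 * v)) * (expR (t1 ^+ 2 / (2 * v)))^-1 < expR ((t2 - t1) * w).
  rewrite -expRB ltr_expR.
  have -> : t2 ^+ 2 / (2 * v) - t1 ^+ 2 / (2 * v) = (t2 - t1) * ((t1 + t2) / (2 * v)).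
    by move: v v0 => u u0; field; rewrite gt_eqF.
  by rewrite ltr_nM2l ?subr_lt0.
have : \forall N \near \oo, mgf h p N beta (m ^+ p) t2 / mgf h p N beta (m ^+ p) t1 <
    expR ((t2 - t1) * w) by apply: (cvgr_lt _ q).
apply: filter_app; near=> N => hlt.
have N0 : (0 < N)%N by near: N; exact: nbhs_infty_gt.
rewrite -(@ltr_nM2l _ (t2 - t1)) ?subr_lt0// -ltr_expR.
exact: le_lt_trans (jensen_mgf _ _ N0 _ _ _ _) hlt.
Unshelve. all: by end_near. Qed.

Lemma mle_sandwich z e : 0 < e -> exists2 r, 0 < r & \forall N \near \oo,
  forall (x : {ffun 'I_N -> bool}) (b : \bar R), `|zx N x - z| < r -> is_mle h p x b ->
  ((beta + (z - e) / Num.sqrt N%:R)%:E <= b <= (beta + (z + e) / Num.sqrt N%:R)%:E)%E.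
Proof.
move=> e0; have v0 := v_gt0.
(* The secant slopes over [z - e, z] and [z, z + e] are z/v - e/(2v) and z/v + e/(2v); allowing the
   data an error e/(8v) leaves a margin 3e/(8v) on either side. *)
have d0 : 0 < e / (8 * v) by rewrite divr_gt0// mulr_gt0.
have [r r0 hr] := sqrtN_power_close z d0; exists r => //.
have gl : \forall N \near \oo, Num.sqrt N%:R *
    (cw_mean_p (beta + (z - e) / Num.sqrt N%:R) h p N - m ^+ p) < z / v - e / (8 * v).
  apply: (@scaled_mean_lt (z - e) z); first by rewrite gtrBl.
  rewrite -subr_gt0 (_ : _ - _ = 3 * (e / (8 * v))); first exact: mulr_gt0.
  by move: v v0 => u u0; field; rewrite gt_eqF.
have gu : \forall N \near \oo, z / v + e / (8 * v) < Num.sqrt N%:R *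
    (cw_mean_p (beta + (z + e) / Num.sqrt N%:R) h p N - m ^+ p).
  apply: (@scaled_mean_gt (z + e) z); first by rewrite ltrDl.
  rewrite -subr_gt0 (_ : _ - _ = 3 * (e / (8 * v))); first exact: mulr_gt0.
  by move: v v0 => u u0; field; rewrite gt_eqF.
near=> N => x b xz bx.
have N0 : (0 < N)%N by near: N; exact: nbhs_infty_gt.
have s0 := sqrtN_gt0 R N0.
have : `|Num.sqrt N%:R * (mag R x ^+ p - m ^+ p) - z / v| <= e / (8 * v).
  move: x b xz bx; suff : forall x : {ffun 'I_N -> bool}, `|zx N x - z| < r ->
    `|Num.sqrt N%:R * (mag R x ^+ p - m ^+ p) - z / v| <= e / (8 * v) by move=> + x b xz _; apply.
  by near: N.
rewrite ler_norml => /andP[h1 h2]; apply/andP; split.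
  apply: (mle_ge N0 bx); rewrite -(ltrD2r (- m ^+ p)) -(ltr_pM2l s0).
  by apply: lt_le_trans (_ : z / v - e / (8 * v) <= _); [near: N|move: h1; lra].
apply: (mle_le N0 bx); rewrite -(ltrD2r (- m ^+ p)) -(ltr_pM2l s0).
by apply: le_lt_trans (_ : _ <= z / v + e / (8 * v)) _; [move: h2; lra|near: N].
Unshelve. all: by end_near. Qed.

Lemma continuous_EFin : continuous (@EFin R).
Proof. by move=> x; apply: cvg_EFin; [exact: nearW|exact: cvg_id]. Qed.

Theorem mle_asymptotic_normality (bhat : forall N : nat, {ffun 'I_N -> bool} -> \bar R) :
  (forall N (x : {ffun 'I_N -> bool}), is_mle h p x (bhat N x)) ->
  conv_dist (fun N => @cw_prob R beta h p N)
    (fun N x => ((Num.sqrt N%:R)%:E * (bhat N x - beta%:E))%E)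
    (fun f => Rintegral mu setT (fun y => f y%:E * gauss_pdf v y)).
Proof.
move=> hb f cf [M fM].
have cfE : continuous (f \o EFin).
  by move=> x; apply: continuous_comp; [exact: continuous_EFin|exact: cf].
have M0 : 0 <= M by exact: le_trans (normr_ge0 _) (fM 0%E).
apply: (@laplace_expectation R beta h p kappa m a c kappa_neq0 Hm
  (fun N x => f ((Num.sqrt N%:R)%:E * (bhat N x - beta%:E))%E)
  (fun z => f z%:E) M set0).
- exact: continuous_measurable_fun.
- exact: negligible_set0.
- move=> N x N0; apply: (le_trans (fM _)); rewrite ler_peMr//.
  by rewrite -[leLHS]expR0 ler_expR mulr_ge0.
- move=> z _ e e0; have /cvgrPdist_le/(_ _ e0)[d /= d0 hd] := cfE z.
  have d20 : 0 < d / 2 by rewrite divr_gt0.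
  have [r r0 hr] := mle_sandwich z d20; exists r => //.
  near=> N => x xz; have N0 : (0 < N)%N by near: N; exact: nbhs_infty_gt.
  have s0 := sqrtN_gt0 R N0.
  have hN : forall (x : {ffun 'I_N -> bool}) (b : \bar R), `|zx N x - z| < r -> is_mle h p x b ->
    ((beta + (z - d / 2) / Num.sqrt N%:R)%:E <= b <= (beta + (z + d / 2) / Num.sqrt N%:R)%:E)%E.
    by near: N.
  (* The sandwich between two real numbers excludes both infinite values. *)
  have := hN x _ xz (hb N x); case: (bhat N x) => [b| |]//=.
  + rewrite !lee_fin -lerBrDl -[in X in _ && X]lerBlDl ler_pdivrMr// ler_pdivlMr// => /andP[b1 b2].
    rewrite -EFinB -EFinM distrC; apply: hd => /=.
    by rewrite [X in z - X]mulrC ltr_norml; lra.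
  + by rewrite [(+oo <= _)%E]leNgt ltry andbF.
Unshelve. all: by end_near. Qed.

End Fluctuations.

(** * Limit laws at a zero maximizer *)

Section GaussMoments.
Variable R : realType.
Local Notation mu := (@lebesgue_measure R).
Local Notation g := (@gauss_pdf R 1).

Lemma integrable_indic_gauss (D : set R) : measurable D ->
  mu.-integrable setT (fun x => (\1_D x * g x)%:E).
Proof.
move=> mD; apply: le_integrable (integrable_gauss_pdf (ltr01 : 0 < 1 :> R)) => //.
  apply/measurable_EFinP; apply: measurable_funM; first exact: measurable_indic.
  exact: measurable_gauss_pdf.
move=> x _; rewrite /= lee_fin normrM ler_piMl//.
by rewrite indicE; case: (_ \in _); rewrite ?normr1 ?normr0.
Qed.

(** The integrand equals w on D and u off D, so the integral is the mixture in which both laws of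
    case (b) are written. *)
Lemma two_valued_gauss (D : set R) (u w : R) : measurable D ->
  Rintegral mu setT (fun x => (u + (w - u) * \1_D x) * g x) =
  Rintegral mu D g * w + (1 - Rintegral mu D g) * u.
Proof.
move=> mD; have ig := integrable_gauss_pdf (ltr01 : 0 < 1 :> R).
have iD := integrable_indic_gauss mD.
under eq_Rintegral do rewrite mulrDl -mulrA.
rewrite RintegralD//; first last.
- exact: (integrableZl measurableT (w - u) iD).
- exact: (integrableZl measurableT u ig).
rewrite RintegralZl// RintegralZl//.
have -> : Rintegral mu setT g = 1 by rewrite /Rintegral integral_gauss_pdf.
have -> : Rintegral mu setT (fun x => \1_D x * g x) = Rintegral mu D g.
  rewrite [RHS]Rintegral_mkcond; apply: eq_Rintegral => x _.
  by rewrite patchE indicE; case: (_ \in _); rewrite ?mul1r ?mul0r.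
by ring.
Qed.

Lemma addrr_eq1 (x : R) : x + x = 1 -> x = 2^-1.
Proof. by move=> ?; lra. Qed.

Lemma gauss_half : Rintegral mu `]0, +oo[%classic g = 2^-1.
Proof.
have g01 : 0 < 1 :> R := ltr01.
have ig := integrable_gauss_pdf g01.
have m0y : measurable (`]0, +oo[%classic : set R) by exact: measurable_itv.
have E1 : Rintegral mu setT g = 1 by rewrite /Rintegral integral_gauss_pdf.
have E2 : Rintegral mu setT g = Rintegral mu `]-oo, 0]%classic g + Rintegral mu `]0, +oo[%classic g.
  rewrite -Rintegral_setU//; first last.
  - rewrite disj_set2E; apply/eqP/seteqP; split => x //=.
    by rewrite !in_itv/= andbT => -[]; rewrite leNgt => /negP.
  - by apply: integrableS ig => //; exact: measurableU.
  congr Rintegral; apply/seteqP; split => x //= _; rewrite !in_itv/= andbT.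
  by have [|] := leP x 0; [left|right].
have E3 : Rintegral mu `]-oo, 0]%classic g = Rintegral mu `]0, +oo[%classic g.
  rewrite /Rintegral; congr fine.
  rewrite -[in LHS]oppr0 ge0_integration_by_substitutionNy//=; first last.
  - by move=> x _; rewrite ltW// gauss_pdf_gt0.
  - by apply: continuous_subspaceT; exact: continuous_gauss_pdf.
  rewrite -integral_itv_obnd_cbnd.
    by apply: eq_integral => x _; rewrite gauss_pdfN.
  apply/measurable_EFinP; apply: measurable_funTS.
  apply: measurableT_comp => //; exact: measurable_gauss_pdf.
by apply: addrr_eq1; rewrite -[RHS]E1 E2 E3.
Qed.

End GaussMoments.

Section Subcritical.
Variables (R : realType) (p : nat).
Hypothesis p3 : (3 <= p)%N.
Local Notation mu := (@lebesgue_measure R).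
Local Notation T := (tilde_beta R p).
Local Notation Mp := (Rintegral mu setT (fun x => x ^+ p * @gauss_pdf R 1 x)).
Local Notation zx N x := (1 * (Num.sqrt N%:R * (mag R x - 0))).

(** From |x|^n / n! <= exp |x|; the factorial is repeated in the exponent so that one constant fits
    the growth hypothesis of [laplace_expectation]. *)
Lemma power_expR_bound n (x : R) : `|x ^+ n| <= n`!%:R * expR (n`!%:R * `|x|).
Proof.
have f1 : 1 <= n`!%:R :> R by rewrite ler1n fact_gt0.
apply: (@le_trans _ _ (n`!%:R * expR `|x|)); last first.
  by rewrite ler_wpM2l// ler_expR ler_peMl.
case: n f1 => [|n] f1; first by rewrite expr0 normr1 mul1r -[leLHS]expR0 ler_expR.
rewrite normrX -ler_pdivrMl ?ltr0n ?fact_gt0// mulrC.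
by apply: le_trans (expR_ge1Dxn n (normr_ge0 x)); rewrite lerDr.
Qed.

(** The limit does not depend on b: the curvature of the energy at 0 is 1 for all these parameters,
    which the scale N^(-p/2) therefore cannot separate. *)
Lemma mean_cvg b c : laplace_point (Hfun b 0 p) 0 1 c ->
  Num.sqrt N%:R ^+ p * cw_mean_p b 0 p N @[N --> \oo] --> Mp.
Proof.
move=> Hc.
have := @laplace_expectation R b 0 p 1 0 1 c (oner_neq0 _) Hc
  (fun N x => (Num.sqrt N%:R * mag R x) ^+ p) (fun z => z ^+ p) p`!%:R set0.
rewrite expr1n divr1 => /(_ _ _ _ _) L.
have {L} : (fun N => cw_expect b 0 p
    (fun x : {ffun 'I_N -> bool} => (Num.sqrt N%:R * mag R x) ^+ p)) @ \oo --> Mp.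
  apply: L.
  - by apply: continuous_measurable_fun; exact: exprn_continuous.
  - exact: negligible_set0.
  - by move=> N x N0; rewrite mul1r subr0; exact: power_expR_bound.
  - move=> z _ e e0; have /cvgrPdist_le/(_ _ e0)[r /= r0 hr] := @exprn_continuous R p z.
    exists r => //; apply: nearW => N x; rewrite mul1r subr0 => xz.
    by rewrite distrC; apply: hr; rewrite /= distrC.
apply: cvg_trans; apply: near_eq_cvg; apply: nearW => N.
by rewrite /cw_expect /cw_mean_p mulr_sumr; apply: eq_bigr => x _; rewrite exprMn; ring.
Qed.

Lemma power_close z e : 0 < e -> exists2 r, 0 < r &
  \forall N \near \oo, forall x : {ffun 'I_N -> bool}, `|zx N x - z| < r ->
    `|z ^+ p - Num.sqrt N%:R ^+ p * mag R x ^+ p| <= e.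
Proof.
move=> e0; have /cvgrPdist_le/(_ _ e0)[r /= r0 hr] := @exprn_continuous R p z.
exists r => //; apply: nearW => N x; rewrite mul1r subr0 => xz.
by rewrite -exprMn; apply: hr; rewrite /= distrC.
Qed.

Lemma mle_ge_subcritical b c z : laplace_point (Hfun b 0 p) 0 1 c -> Mp < z ^+ p ->
  exists2 r, 0 < r & \forall N \near \oo,
    forall (x : {ffun 'I_N -> bool}) (y : \bar R), `|zx N x - z| < r ->
    is_mle 0 p x y -> (b%:E <= y)%E.
Proof.
move=> Hc lt; have e0 : 0 < (z ^+ p - Mp) / 2 by rewrite divr_gt0// subr_gt0.
have [r r0 hr] := power_close z e0; exists r => //.
have : \forall N \near \oo, Num.sqrt N%:R ^+ p * cw_mean_p b 0 p N < (z ^+ p + Mp) / 2.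
  by apply: (cvgr_lt _ (mean_cvg Hc)); lra.
apply: filterS3 hr (nbhs_infty_gt 0) => N hN N0 hm x y /hN; rewrite ler_norml => /andP[_ h1] hy.
apply: (mle_ge N0 hy); rewrite -(@ltr_pM2l _ (Num.sqrt N%:R ^+ p)) ?exprn_gt0 ?sqrtN_gt0//.
by apply: (lt_le_trans hm); lra.
Qed.

Lemma mle_le_subcritical b c z : laplace_point (Hfun b 0 p) 0 1 c -> z ^+ p < Mp ->
  exists2 r, 0 < r & \forall N \near \oo,
    forall (x : {ffun 'I_N -> bool}) (y : \bar R), `|zx N x - z| < r ->
    is_mle 0 p x y -> (y <= b%:E)%E.
Proof.
move=> Hc lt; have e0 : 0 < (Mp - z ^+ p) / 2 by rewrite divr_gt0// subr_gt0.
have [r r0 hr] := power_close z e0; exists r => //.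
have : \forall N \near \oo, (z ^+ p + Mp) / 2 < Num.sqrt N%:R ^+ p * cw_mean_p b 0 p N.
  by apply: (cvgr_gt _ (mean_cvg Hc)); lra.
apply: filterS3 hr (nbhs_infty_gt 0) => N hN N0 hm x y /hN; rewrite ler_norml => /andP[h1 _] hy.
apply: (mle_le N0 hy); rewrite -(@ltr_pM2l _ (Num.sqrt N%:R ^+ p)) ?exprn_gt0 ?sqrtN_gt0//.
by apply: le_lt_trans hm; lra.
Qed.

(** X^p is of order N^(-p/2), to be compared with supercritical means that stay away from 0. *)
Lemma power_small z e : 0 < e -> exists2 r, 0 < r &
  \forall N \near \oo, forall x : {ffun 'I_N -> bool}, `|zx N x - z| < r ->
    `|mag R x ^+ p| < e.
Proof.
move=> e0; have [r r0 hr] := power_close z ltr01; exists r => //.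
near=> N => x xz.
have N0 : (0 < N)%N by near: N; exact: nbhs_infty_gt.
have s0 := sqrtN_gt0 R N0.
have sp : 0 < Num.sqrt N%:R ^+ p :> R by rewrite exprn_gt0.
have h1 : `|z ^+ p - Num.sqrt N%:R ^+ p * mag R x ^+ p| <= 1.
  move: x xz; suff : forall x : {ffun 'I_N -> bool}, `|zx N x - z| < r ->
    `|z ^+ p - Num.sqrt N%:R ^+ p * mag R x ^+ p| <= 1 by [].
  by near: N.
have h2 : Num.sqrt N%:R ^+ p * `|mag R x ^+ p| <= `|z ^+ p| + 1.
  rewrite -{1}(gtr0_norm sp) -normrM.
  rewrite -[X in `|X| <= _](subKr (z ^+ p)) (le_trans (ler_normB _ _))//.
  by rewrite lerD2l.
rewrite -(ltr_pM2l sp); apply: (le_lt_trans h2); rewrite -ltr_pdivrMr//.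
apply: (@lt_le_trans _ _ (Num.sqrt N%:R)).
  by near: N; have := @cvg_sqrt_nat R => /cvgryPgt; apply.
rewrite -[leLHS]expr1 ler_weXn2l//; last exact: leq_trans p3.
rewrite -[leLHS]sqrtr1 ler_wsqrtr// ler1n//.
Unshelve. all: by end_near. Qed.

Lemma mle_le_supercritical b z : T < b ->
  exists2 r, 0 < r & \forall N \near \oo,
    forall (x : {ffun 'I_N -> bool}) (y : \bar R), `|zx N x - z| < r ->
    is_mle 0 p x y -> (y <= b%:E)%E.
Proof.
move=> Tb; have b0 : 0 < b by apply: le_lt_trans Tb; exact: tilde_beta_ge0.
have [x0 x01 Hx0] := above_tilde_beta p3 Tb.
have [eta eta0 he] := mean_away x01 Hx0.
have e0 : 0 < eta / b by rewrite divr_gt0.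
have [r r0 hr] := power_small z e0; exists r => //.
apply: filterS3 hr he (nbhs_infty_gt 0) => N hN hm N0 x y /hN; rewrite ltr_norml => /andP[_ h1] hy.
apply: (mle_le N0 hy); apply: (lt_le_trans h1).
by rewrite ler_pdivrMr// mulrC.
Qed.

Lemma mle_ge_supercritical b z : odd p -> T < b ->
  exists2 r, 0 < r & \forall N \near \oo,
    forall (x : {ffun 'I_N -> bool}) (y : \bar R), `|zx N x - z| < r ->
    is_mle 0 p x y -> ((- b)%:E <= y)%E.
Proof.
move=> op Tb; have b0 : 0 < b by apply: le_lt_trans Tb; exact: tilde_beta_ge0.
have [x0 x01 Hx0] := above_tilde_beta p3 Tb.
have x01' : -1 <= - x0 <= 1 by lra.
have Hx0' : 0 < Hfun (- b) 0 p (- x0).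
  by move: Hx0; rewrite /Hfun !mul0r !addr0 IentN exprNn -signr_odd op expr1 mulN1r mulrNN.
have [eta eta0 he] := mean_away x01' Hx0'.
have e0 : 0 < eta / b by rewrite divr_gt0.
have [r r0 hr] := power_small z e0; exists r => //.
apply: filterS3 hr he (nbhs_infty_gt 0) => N hN hm N0 x y /hN; rewrite ltr_norml => /andP[h1 _] hy.
apply: (mle_ge N0 hy); apply: le_lt_trans h1.
by rewrite lerNr ler_pdivrMr// mulNr mulrC -mulNr.
Qed.

Lemma mean0_odd N : odd p -> cw_mean_p 0 0 p N = 0 :> R.
Proof.
move=> op; pose flip (x : {ffun 'I_N -> bool}) := [ffun i => ~~ x i].
have flipK : involutive flip by move=> x; apply/ffunP => i; rewrite !ffunE negbK.
have magN x : mag R (flip x) = - mag R x.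
  rewrite /mag -mulNr -sumrN; congr (_ / _); apply: eq_bigr => i _.
  by rewrite ffunE /spin; case: (x i); rewrite ?opprK.
have E : cw_mean_p 0 0 p N = - cw_mean_p 0 0 p N :> R.
  rewrite {1}/cw_mean_p (reindex_inj (inv_inj flipK)) -sumrN; apply: eq_bigr => x _.
  rewrite magN exprNn -signr_odd op expr1 mulN1r mulrN; congr (- (_ * _)).
  by rewrite !cw_probE /cw_weight !mul0r.
by move: E; lra.
Qed.

(** The spin flip makes the mean at b = 0 vanish for every N, and [mean_cvg] passes this to the
    Gaussian moment. *)
Lemma odd_moment : odd p -> 0 < T -> Mp = 0.
Proof.
move=> op T0; have [|x|c Hc] := @laplace_point_subcritical R p p3 0 0; first by rewrite lexx.
  by rewrite !mul0r.
have := mean_cvg Hc; under eq_fun do rewrite mean0_odd// mulr0.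
by move=> h; apply/esym; exact: (cvg_unique _ (cvg_cst _) h).
Qed.

Lemma laplace_point_odd b : `|b| < T -> exists c, laplace_point (Hfun b 0 p) 0 1 c.
Proof.
move=> bT; apply: (@laplace_point_subcritical R p p3 b `|b|); first by rewrite normr_ge0.
by move=> x; rewrite -normrX -normrM ler_norm.
Qed.

Lemma laplace_point_even b : ~~ odd p -> 0 < T -> b < T ->
  exists c, laplace_point (Hfun b 0 p) 0 1 c.
Proof.
move=> ep T0 bT; apply: (@laplace_point_subcritical R p p3 b (Num.max b 0)).
  by rewrite le_max lexx orbT gt_max bT.
have xp x : `|x| ^+ p = x ^+ p :> R by rewrite -normrX ger0_norm// exprn_even_ge0.
by move=> x; rewrite xp ler_wpM2r ?le_max ?lexx// exprn_even_ge0.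
Qed.

End Subcritical.

Section SubcriticalLaw.
Variables (R : realType) (p : nat) (beta : R).
Variable bhat : forall N : nat, {ffun 'I_N -> bool} -> \bar R.
Hypothesis p3 : (3 <= p)%N.
Hypothesis hb : forall N (x : {ffun 'I_N -> bool}), is_mle 0 p x (@bhat N x).
Hypothesis beta0 : 0 <= beta.
Local Notation mu := (@lebesgue_measure R).
Local Notation T := (tilde_beta R p).
Hypothesis betaT : beta < T.
Local Notation Mp := (Rintegral mu setT (fun x => x ^+ p * @gauss_pdf R 1 x)).
Local Notation zx N x := (1 * (Num.sqrt N%:R * (mag R x - 0))).

Let T0 : 0 < T. Proof. exact: le_lt_trans betaT. Qed.

Lemma ereal_continuous_close (f : \bar R -> R) (t e : R) : continuous f -> 0 < e ->
  exists2 d, 0 < d & forall y : \bar R,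
    ((t - d)%:E <= y <= (t + d)%:E)%E -> `|f y - f t%:E| <= e.
Proof.
move=> cf e0.
have cfE : continuous (f \o EFin).
  by move=> x; apply: continuous_comp; [exact: continuous_EFin|exact: cf].
have /cvgrPdist_le/(_ _ e0)[d /= d0 hd] := cfE t.
exists (d / 2); first by rewrite divr_gt0.
case=> [y| |]; rewrite ?leye_eq ?leeNy_eq ?andbF//=.
rewrite !lee_fin => /andP[h1 h2]; rewrite distrC; apply: hd => /=.
by rewrite ltr_norml; lra.
Qed.

Lemma negligible_set1 (t : R) : mu.-negligible [set t].
Proof. by apply/negligibleP => //; exact: lebesgue_measure_set1. Qed.

Lemma subcritical_expectation (f : \bar R -> R) (M : R) (Psi : R -> R) (A : set R) :
  (forall y, `|f y| <= M) -> measurable_fun setT Psi -> mu.-negligible A ->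
  (forall z, ~ A z -> forall e, 0 < e -> exists2 r, 0 < r &
    \forall N \near \oo, forall x : {ffun 'I_N -> bool},
      `|zx N x - z| < r -> `|f (@bhat N x) - Psi z| <= e) ->
  \sum_(x : {ffun 'I_N -> bool}) cw_prob beta 0 p x * f (@bhat N x) @[N --> \oo] -->
  Rintegral mu setT (fun z => Psi z * gauss_pdf 1 z).
Proof.
move=> fM mPsi A0 hP.
have [|x|c Hc] := @laplace_point_subcritical R p p3 beta beta; first by rewrite beta0.
  by rewrite ler_wpM2l// -normrX ler_norm.
have M0 : 0 <= M by exact: le_trans (normr_ge0 _) (fM 0%E).
have := @laplace_expectation R beta 0 p 1 0 1 c (oner_neq0 _) Hc
  (fun N x => f (@bhat N x)) Psi M A mPsi A0.
rewrite expr1n divr1; apply => // N x N0.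
by apply: (le_trans (fM _)); rewrite ler_peMr// -[leLHS]expR0 ler_expR mulr_ge0.
Qed.

Lemma subcritical_law_odd : odd p ->
  conv_dist (fun N => @cw_prob R beta 0 p N) bhat
    (fun f => 2^-1 * f T%:E + 2^-1 * f (- T)%:E).
Proof.
move=> op f cf [M fM]; have Mp0 := odd_moment p3 op T0.
pose D : set R := `]0, +oo[%classic.
have mD : measurable D by exact: measurable_itv.
have -> : 2^-1 * f T%:E + 2^-1 * f (- T)%:E =
    Rintegral mu setT (fun z => (f (- T)%:E + (f T%:E - f (- T)%:E) * \1_D z) * gauss_pdf 1 z).
  by rewrite two_valued_gauss// gauss_half; field.
apply: (@subcritical_expectation f M _ [set 0] fM).
- apply: measurable_funD; first exact: measurable_cst.
  by apply: measurable_funM; [exact: measurable_cst|exact: measurable_indic].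
- exact: negligible_set1.
move=> z /eqP z0 e e0.
(* The minimum with T keeps the comparison parameter in [0, T), so that its absolute value is
   subcritical. *)
have lp d : 0 < d -> exists c, laplace_point (Hfun (T - Num.min d T) 0 p) 0 1 c.
  move=> d0; apply: laplace_point_odd => //.
  have : Num.min d T <= T by rewrite ge_min lexx orbT.
  have : 0 < Num.min d T by rewrite lt_min d0.
  by move=> h1 h2; rewrite ger0_norm; lra.
have md d : Num.min d T <= d by rewrite ge_min lexx.
have [zneg|zpos|zE] := ltgtP z 0; last by rewrite zE eqxx in z0.
- rewrite indicE memNset ?mulr0 ?addr0; last by rewrite /D/= in_itv/= andbT => ?; lra.
  have [d d0 hd] := ereal_continuous_close (- T) cf e0.
  have [c Hc] : exists c, laplace_point (Hfun (- (T - Num.min d T)) 0 p) 0 1 c.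
    apply: laplace_point_odd => //; rewrite normrN.
    have : Num.min d T <= T by rewrite ge_min lexx orbT.
    have : 0 < Num.min d T by rewrite lt_min d0.
    by move=> h1 h2; rewrite ger0_norm; lra.
  have zp : z ^+ p < Mp by rewrite Mp0 exprn_odd_lt0.
  have [r1 r10 h1] := mle_le_subcritical Hc zp.
  have Td : T < T + d by rewrite ltrDl.
  have [r2 r20 h2] := mle_ge_supercritical p3 z op Td.
  exists (Num.min r1 r2); first by rewrite lt_min r10.
  apply: filterS2 h1 h2 => N h1 h2 x; rewrite lt_min => /andP[xr1 xr2].
  apply: hd; rewrite -opprD (h2 _ _ xr2 (hb x))/=.
  apply: (le_trans (h1 _ _ xr1 (hb x))); rewrite lee_fin.
  by have := md d; lra.
- rewrite indicE mem_set ?mulr1; last by rewrite /D/= in_itv/= andbT.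
  rewrite addrC subrK; have [d d0 hd] := ereal_continuous_close T cf e0.
  have [c Hc] := lp d d0.
  have zp : Mp < z ^+ p by rewrite Mp0 exprn_gt0.
  have [r1 r10 h1] := mle_ge_subcritical Hc zp.
  have Td : T < T + d by rewrite ltrDl.
  have [r2 r20 h2] := mle_le_supercritical p3 z Td.
  exists (Num.min r1 r2); first by rewrite lt_min r10.
  apply: filterS2 h1 h2 => N h1 h2 x; rewrite lt_min => /andP[xr1 xr2].
  apply: hd; rewrite (h2 _ _ xr2 (hb x)) andbT.
  apply: le_trans (h1 _ _ xr1 (hb x)); rewrite lee_fin.
  by have := md d; lra.
Qed.

(** The level set is empty or consists of w and -w for one root w. *)
Lemma negligible_power_level : ~~ odd p -> mu.-negligible [set z : R | z ^+ p = Mp].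
Proof.
move=> ep; have p0 : (0 < p)%N by exact: leq_trans p3.
have [[w wM]|no] := pselect (exists w, w ^+ p = Mp); last first.
  rewrite (_ : [set _ | _] = set0); first exact: negligible_set0.
  by apply/seteqP; split => // z zM; apply: no; exists z.
apply: (negligibleS _ (negligibleU (negligible_set1 w) (negligible_set1 (- w)))) => z /= zM.
have : `|z| ^+ p = `|w| ^+ p by rewrite -!normrX zM wM.
move=> /eqP; rewrite eqrXn2 ?normr_ge0// eqr_norml normr_ge0 andbT.
have [w0|w0] := ger0P w; rewrite ?opprK => /orP[]/eqP ->; by [left|right].
Qed.

Lemma subcritical_law_even : ~~ odd p ->
  conv_dist (fun N => @cw_prob R beta 0 p N) bhat
    (fun f => gamma_p R p * f -oo%E + (1 - gamma_p R p) * f T%:E).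
Proof.
move=> ep f cf [M fM].
pose D : set R := [set z | z ^+ p <= Mp].
have mD : measurable D.
  have mX : measurable_fun setT (fun z : R => z ^+ p).
    by apply: continuous_measurable_fun; exact: exprn_continuous.
  have := mX measurableT `]-oo, Mp]%classic (measurable_itv _); rewrite setTI.
  by congr measurable; apply/seteqP; split => z; rewrite /D /= in_itv.
rewrite /gamma_p -/D -two_valued_gauss//.
apply: (@subcritical_expectation f M _ [set z | z ^+ p = Mp] fM).
- apply: measurable_funD; first exact: measurable_cst.
  by apply: measurable_funM; [exact: measurable_cst|exact: measurable_indic].
- exact: negligible_power_level.
move=> z /= /eqP zM e e0.
have [lt|gt|E] := ltgtP (z ^+ p) Mp; last by rewrite E eqxx in zM.
- rewrite indicE mem_set ?mulr1; last exact: ltW.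
  rewrite addrC subrK; have /cvgrPdist_le/(_ _ e0)[B [_ hB]] := cf -oo%E.
  (* Every estimate below B is in the chosen neighborhood of -oo; the parameter is taken below B
     and, by the minimum with 0, below T. *)
  have [|c Hc] := @laplace_point_even R p p3 (Num.min (B - 1) 0) ep T0.
    by rewrite gt_min T0 orbT.
  have [r r0 h1] := mle_le_subcritical Hc lt; exists r => //.
  apply: filterS h1 => N h1 x xr; rewrite distrC; apply: hB.
  apply: (le_lt_trans (h1 _ _ xr (hb x))); rewrite lte_fin.
  by rewrite gt_min ltrBlDr ltrDl ltr01.
- rewrite indicE memNset ?mulr0 ?addr0; last by rewrite /D/= leNgt gt.
  have [d d0 hd] := ereal_continuous_close T cf e0.
  have [|c Hc] := @laplace_point_even R p p3 (T - d) ep T0; first by rewrite gtrBl.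
  have [r1 r10 h1] := mle_ge_subcritical Hc gt.
  have Td : T < T + d by rewrite ltrDl.
  have [r2 r20 h2] := mle_le_supercritical p3 z Td.
  exists (Num.min r1 r2); first by rewrite lt_min r10.
  apply: filterS2 h1 h2 => N h1 h2 x; rewrite lt_min => /andP[xr1 xr2].
  by apply: hd; rewrite (h2 _ _ xr2 (hb x)) (h1 _ _ xr1 (hb x)).
Qed.

End SubcriticalLaw.

Theorem mainTheorem6 (R : realType) (p : nat) (beta h mstar : R)
  (bhat : forall N : nat, {ffun 'I_N -> bool} -> \bar R) :
  (3 <= p)%N -> 0 <= beta -> p_regular p beta h ->
  is_gmax beta h p mstar ->
  (forall N (x : {ffun 'I_N -> bool}), is_mle h p x (bhat N x)) ->
  (mstar != 0 ->
     conv_dist (fun N => @cw_prob R beta h p N)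
       (fun N x => ((Num.sqrt N%:R)%:E * (bhat N x - beta%:E))%E)
       (fun f => Rintegral lebesgue_measure setT
          (fun y => f y%:E *
             gauss_pdf (- H2 beta h p mstar / (p%:R ^+ 2 * mstar ^+ (2 * p - 2))) y)))
  /\ (mstar = 0 <-> h = 0 /\ beta < tilde_beta R p)
  /\ (mstar = 0 ->
       (odd p ->
          conv_dist (fun N => @cw_prob R beta h p N) bhat
            (fun f => 2^-1 * f (tilde_beta R p)%:E + 2^-1 * f (- tilde_beta R p)%:E))
       /\ (~~ odd p ->
          conv_dist (fun N => @cw_prob R beta h p N) bhat
            (fun f => gamma_p R p * f -oo%E + (1 - gamma_p R p) * f (tilde_beta R p)%:E))).
Proof.
move=> p3 beta0 reg gm hb; have p0 : (0 < p)%N by exact: leq_trans p3.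
have [c Hc] := p_regular_laplace_point reg gm.
have iff0 := gmax0_iff p3 reg gm beta0.
split; [move=> m0|split => //].
  (* The stated variance is kappa^2 / a with a = - H'' and kappa = a / (p m^(p-1)). *)
  have -> : - H2 beta h p mstar / (p%:R ^+ 2 * mstar ^+ (2 * p - 2)) =
      (- H2 beta h p mstar / (p%:R * mstar ^+ p.-1)) ^+ 2 / - H2 beta h p mstar.
    have -> : (2 * p - 2 = p.-1 * 2)%N by rewrite -subn1 mulnBl mul1n mulnC.
    have q0 : mstar ^+ p.-1 != 0 by rewrite expf_neq0.
    have n0 : p%:R != 0 :> R by rewrite pnatr_eq0 -lt0n.
    have a0 : H2 beta h p mstar != 0 by rewrite lt_eqF// (p_regular_H2 reg gm).
    by rewrite exprM; field; rewrite a0 q0 n0.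
  by apply: (mle_asymptotic_normality p0 m0 Hc).
move=> E; have [h0 bT] := iff0.1 E; subst h; split => op.
  exact: subcritical_law_odd.
exact: subcritical_law_even.
Qed.
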